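(* Let $z\in\mathbb{C}\setminus(\partial\mathbb{D}\cup\{0\})$ and fix $k_0,k_1\in\mathbb{Z}$. Then the resolvent $(U-zI)^{-1}$ of the unitary CMV operator $U$ on $\ell^2(\mathbb{Z})$ is given in terms of its matrix representation in the standard basis of $\ell^2(\mathbb{Z})$ by, for $k,k'\in\mathbb{Z}$, $$(U-zI)^{-1}(k,k')=\frac{(-1)^{k_1+1}}{z\,W\left(\binom{u_+(z,k_1,k_0)}{v_+(z,k_1,k_0)},\binom{u_-(z,k_1,k_0)}{v_-(z,k_1,k_0)}\right)}\begin{cases}u_-(z,k,k_0)v_+(z,k',k_0),& k<k'\text{ or }k=k'\text{ odd},\\ v_-(z,k',k_0)u_+(z,k,k_0),& k'<k\text{ or }k=k'\text{ even},\end{cases}$$ $$\phantom{(U-zI)^{-1}(k,k')}=\frac{-1}{2z[M_+(z,k_0)-M_-(z,k_0)]}\begin{cases}\widetilde u_-(z,k,k_0)v_+(z,k',k_0),& k<k'\text{ or }k=k'\text{ odd},\\ v_-(z,k',k_0)\widetilde u_+(z,k,k_0),& k'<k\text{ or }k=k'\text{ even},\end{cases}$$ where $$W\left(\binom{u_+(z,k_1,k_0)}{v_+(z,k_1,k_0)},\binom{u_-(z,k_1,k_0)}{v_-(z,k_1,k_0)}\right)=\det\begin{pmatrix}u_+(z,k_1,k_0)&u_-(z,k_1,k_0)\\ v_+(z,k_1,k_0)&v_-(z,k_1,k_0)\end{pmatrix}=(-1)^{k_1}[M_+(z,k_0)-M_-(z,k_0)]\begin{cases}2z,&k_0\text{ odd},\\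 2,&k_0\text{ even},\end{cases}$$ and $$W\left(\binom{\widetilde u_+(z,k_1,k_0)}{v_+(z,k_1,k_0)},\binom{\widetilde u_-(z,k_1,k_0)}{v_-(z,k_1,k_0)}\right)=2(-1)^{k_1}[M_+(z,k_0)-M_-(z,k_0)].$$ Moreover, since $0\in\mathbb{C}\setminus\sigma(U)$, both formulas for $(U-zI)^{-1}(k,k')$ extend analytically to $z=0$.
   Context: $\mathbb{D}$ is the open unit disk in $\mathbb{C}$ and $\partial\mathbb{D}$ the unit circle. Let $\{\alpha_k\}_{k\in\mathbb{Z}}\subset\mathbb{D}$ and $\rho_k=\sqrt{1-|\alpha_k|^2}$. $[k_0,-\infty)\cap\mathbb{Z}$ means $(-\infty,k_0]\cap\mathbb{Z}$. CMV operator: $\theta_k=\begin{pmatrix}-\alpha_k&\rho_k\\ \rho_k&\overline{\alpha_k}\end{pmatrix}$. $V$ (resp. $W$) is the unitary operator on $\ell^2(\mathbb{Z})$ whose matrix in the standard basis is block diagonal with blocks $\theta_{2k}$ on rows/columns $2k-1,2k$ (resp. $\theta_{2k+1}$ on rows/columns $2k,2k+1$), $k\in\mathbb{Z}$, and $U=VW$. (In the claim, $W(\cdot,\cdot)$ with two vector arguments denotes the Wronskian $W\left(\binom{u_1}{v_1},\binom{u_2}{v_2}\right)=u_1v_2-u_2v_1$.) For $z\in\mathbb{C}\setminus\{0\}$, put $T(z,k)=\frac1{\rho_k}\begin{pmatrix}\alpha_k&z\\ 1/z&\overline{\alpha_k}\end{pmatrix}$ for $k$ odd and $T(z,k)=\frac1{\rho_k}\begin{pmatrix}\overline{\alpha_k}&1\\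 1&\alpha_k\end{pmatrix}$ for $k$ even. The Laurent polynomials $p_+,r_+,q_+,s_+$ (in $z$) are defined for all $k\in\mathbb{Z}$ by requiring that $(u,v)=(p_+,r_+)$ and $(u,v)=(q_+,s_+)$ solve $\binom{u(z,k,k_0)}{v(z,k,k_0)}=T(z,k)\binom{u(z,k-1,k_0)}{v(z,k-1,k_0)}$, $k\in\mathbb{Z}$, with initial values at $k=k_0$: $\binom{p_+}{r_+}=\binom{z}{1}$, $\binom{q_+}{s_+}=\binom{z}{-1}$ if $k_0$ is odd, and $\binom{p_+}{r_+}=\binom{1}{1}$, $\binom{q_+}{s_+}=\binom{-1}{1}$ if $k_0$ is even. Put $\widetilde p_+=p_+/z$, $\widetilde q_+=q_+/z$ if $k_0$ is odd and $\widetilde p_+=p_+$, $\widetilde q_+=q_+$ if $k_0$ is even. For $z\in\mathbb{C}\setminus(\partial\mathbb{D}\cup\{0\})$, $M_\pm(z,k_0)$ are the unique complex numbers such that $\binom{u_\pm(z,\cdot,k_0)}{v_\pm(z,\cdot,k_0)}:=\binom{q_+(z,\cdot,k_0)}{s_+(z,\cdot,k_0)}+M_\pm(z,k_0)\binom{p_+(z,\cdot,k_0)}{r_+(z,\cdot,k_0)}\in\ell^2([k_0,\pm\infty)\cap\mathbb{Z})^2$; $u_\pm,v_\pm$ are defined for all $k\in\mathbb{Z}$ by this formula, and $\widetilde u_\pm(z,k,k_0)=\widetilde q_+(z,k,k_0)+M_\pm(z,k_0)\widetilde p_+(z,k,k_0)$. *)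

(* Defs.v *)
From HB Require Import structures.
From mathcomp Require Import all_boot all_order all_algebra.
From mathcomp Require Import all_classical all_reals all_analysis.
From mathcomp Require Import complex.
From mathcomp Require Import zify ring.

Set Implicit Arguments.
Unset Strict Implicit.
Unset Printing Implicit Defensive.

Import Order.TTheory GRing.Theory Num.Theory.
Import numFieldNormedType.Exports.

Local Open Scope classical_set_scope.
Local Open Scope ring_scope.

Definition oddz (k : int) : bool := odd `|k|%N.

Definition mx22 (K : Type) (a b c d : K) : 'M[K]_2 :=
  \matrix_(i < 2, j < 2)
    if i == 0 then (if j == 0 then a else b) else (if j == 0 then c else d).

Definition cv2 (K : Type) (a b : K) : 'cV[K]_2 :=
  \col_(i < 2) if i == 0 then a else b.

Definition wronskian (K : pzRingType) (x y : 'cV[K]_2) : K :=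
  x 0 0 * y 1 0 - y 0 0 * x 1 0.

(* Local expansion in a convergent power series. *)
Definition analytic_at (K : numFieldType) (f : K -> K) (z0 : K) : Prop :=
  exists a : nat -> K,
    \forall z \near z0, series (fun n => a n * (z - z0) ^+ n) @ \oo --> f z.

Definition sqnorm (R : realType) (D : set int) (f : int -> R[i]) : \bar R :=
  \esum_(k in D) ((Normc.normc (f k) ^+ 2)%:E).

Definition l2 (R : realType) (D : set int) (f : int -> R[i]) : Prop :=
  (sqnorm D f < +oo)%E.

(* Operators are represented by maps on all sequences; only their restriction
   to l^2(Z) matters below. *)
Definition operator (R : realType) : Type := (int -> R[i]) -> (int -> R[i]).

Definition bounded_linear (R : realType) (A : operator R) : Prop :=
  (forall (c : R[i]) (f g : int -> R[i]), l2 setT f -> l2 setT g ->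
     A (c *: f + g) = c *: A f + A g) /\
  (exists K : R, forall f : int -> R[i], l2 setT f ->
     (sqnorm setT (A f) <= K%:E * sqnorm setT f)%E).

Definition is_resolvent (R : realType) (A : operator R) (z : R[i])
    (G : operator R) : Prop :=
  [/\ bounded_linear G,
      forall f, l2 setT f -> A (G f) - z *: G f = f &
      forall f, l2 setT f -> G (A f - z *: f) = f].

Definition spectrum (R : realType) (A : operator R) : set R[i] :=
  [set z | ~ exists G, is_resolvent A z G].

(* (A - z)^-1; a junk value when z belongs to the spectrum of A. *)
Definition resolvent (R : realType) (A : operator R) (z : R[i]) : operator R :=
  xget (fun f : int -> R[i] => f) [set G | is_resolvent A z G].

Definition basis_vector (R : realType) (k : int) : int -> R[i] :=
  fun j => (j == k)%:R.

Definition entry (R : realType) (A : operator R) (k k' : int) : R[i] :=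
  A (@basis_vector R k') k.

Definition rho (R : realType) (alpha : int -> R[i]) (k : int) : R[i] :=
  sqrtC (1 - `|alpha k| ^+ 2).

Definition theta (R : realType) (alpha : int -> R[i]) (k : int) : 'M[R[i]]_2 :=
  mx22 (- alpha k) (rho alpha k) (rho alpha k) (alpha k)^*.

(* The block diagonal operator with the blocks [theta k], for the k of parity
   [b], on rows and columns k - 1, k. *)
Definition block_op (R : realType) (alpha : int -> R[i]) (b : bool) :
    operator R :=
  fun f j =>
    if oddz j == b
    then (theta alpha j *m cv2 (f (j - 1)) (f j)) 1 0
    else (theta alpha (j + 1) *m cv2 (f j) (f (j + 1))) 0 0.

Definition cmvV (R : realType) (alpha : int -> R[i]) : operator R :=
  block_op alpha false.

Definition cmvW (R : realType) (alpha : int -> R[i]) : operator R :=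
  block_op alpha true.

Definition cmvU (R : realType) (alpha : int -> R[i]) : operator R :=
  fun f => cmvV alpha (cmvW alpha f).

Definition transfer (R : realType) (alpha : int -> R[i]) (z : R[i]) (k : int) :
    'M[R[i]]_2 :=
  (rho alpha k)^-1 *:
    (if oddz k then mx22 (alpha k) z z^-1 (alpha k)^*
     else mx22 (alpha k)^* 1 1 (alpha k)).

(* The solution x of x k = transfer z k *m x (k - 1) with x k0 = c; see
   [transfer_sol_init] and [transfer_sol_rec]. *)
Definition transfer_sol (R : realType) (alpha : int -> R[i]) (z : R[i])
    (k0 : int) (c : 'cV[R[i]]_2) (k : int) : 'cV[R[i]]_2 :=
  match k - k0 with
  | Posz n => iteri n (fun i x => transfer alpha z (k0 + i.+1%:Z) *m x) c
  | Negz n =>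
      iteri n.+1 (fun i x => invmx (transfer alpha z (k0 - i%:Z)) *m x) c
  end.

(* The column (p_+, r_+). *)
Definition sol_pr (R : realType) (alpha : int -> R[i]) (z : R[i])
    (k0 k : int) : 'cV[R[i]]_2 :=
  transfer_sol alpha z k0 (if oddz k0 then cv2 z 1 else cv2 1 1) k.

(* The column (q_+, s_+). *)
Definition sol_qs (R : realType) (alpha : int -> R[i]) (z : R[i])
    (k0 k : int) : 'cV[R[i]]_2 :=
  transfer_sol alpha z k0 (if oddz k0 then cv2 z (-1) else cv2 (-1) 1) k.

(* Division by z when k0 is odd: p_+ to p~_+ and q_+ to q~_+. *)
Definition tilde (R : realType) (z : R[i]) (k0 : int) (x : R[i]) : R[i] :=
  if oddz k0 then x / z else x.

(* The sign + is [true], the sign - is [false]. *)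
Definition half_line (s : bool) (k0 : int) : set int :=
  if s then [set k | k0 <= k] else [set k | k <= k0].

Definition weyl_M (R : realType) (alpha : int -> R[i]) (s : bool) (z : R[i])
    (k0 : int) : R[i] :=
  xget 0 [set m : R[i] | forall i : 'I_2,
    l2 (half_line s k0)
       (fun k => (sol_qs alpha z k0 k + m *: sol_pr alpha z k0 k) i 0)].

(* The column (u_s, v_s). *)
Definition weyl_sol (R : realType) (alpha : int -> R[i]) (s : bool) (z : R[i])
    (k k0 : int) : 'cV[R[i]]_2 :=
  sol_qs alpha z k0 k + weyl_M alpha s z k0 *: sol_pr alpha z k0 k.

Definition weyl_u (R : realType) (alpha : int -> R[i]) (s : bool) (z : R[i])
    (k k0 : int) : R[i] :=
  weyl_sol alpha s z k k0 0 0.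

Definition weyl_v (R : realType) (alpha : int -> R[i]) (s : bool) (z : R[i])
    (k k0 : int) : R[i] :=
  weyl_sol alpha s z k k0 1 0.

Definition weyl_ut (R : realType) (alpha : int -> R[i]) (s : bool) (z : R[i])
    (k k0 : int) : R[i] :=
  tilde z k0 (sol_qs alpha z k0 k 0 0) +
  weyl_M alpha s z k0 * tilde z k0 (sol_pr alpha z k0 k 0 0).

Definition green1 (R : realType) (alpha : int -> R[i]) (k0 k1 : int)
    (z : R[i]) (k k' : int) : R[i] :=
  (-1) ^ (k1 + 1) /
    (z * wronskian (cv2 (weyl_u alpha true z k1 k0) (weyl_v alpha true z k1 k0))
                (cv2 (weyl_u alpha false z k1 k0) (weyl_v alpha false z k1 k0)))
  * (if (k < k') || ((k == k') && oddz k)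
     then weyl_u alpha false z k k0 * weyl_v alpha true z k' k0
     else weyl_v alpha false z k' k0 * weyl_u alpha true z k k0).

Definition green2 (R : realType) (alpha : int -> R[i]) (k0 : int)
    (z : R[i]) (k k' : int) : R[i] :=
  -1 / (2 * z * (weyl_M alpha true z k0 - weyl_M alpha false z k0))
  * (if (k < k') || ((k == k') && oddz k)
     then weyl_ut alpha false z k k0 * weyl_v alpha true z k' k0
     else weyl_v alpha false z k' k0 * weyl_ut alpha true z k k0).

Lemma det_mx22 (K : comPzRingType) (a b c d : K) :
  \det (mx22 a b c d) = a * d - b * c.
Proof.
rewrite (expand_det_row _ 0) !big_ord_recl big_ord0 /cofactor !det_mx11 !mxE /=.
by rewrite /bump /= expr0 expr1 mul1r addr0 mulN1r mulrN.
Qed.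

Lemma rho_neq0 (R : realType) (alpha : int -> R[i]) (k : int) :
  `|alpha k| < 1 -> rho alpha k != 0.
Proof. by move=> a1; rewrite sqrtC_eq0 gt_eqF// subr_gt0 expr_lt1. Qed.

Lemma det_transfer (R : realType) (alpha : int -> R[i]) (z : R[i]) (k : int) :
  `|alpha k| < 1 -> z != 0 -> \det (transfer alpha z k) = -1.
Proof.
move=> a1 z0; have r0 := rho_neq0 a1.
have e : `|alpha k| ^+ 2 - 1 = - rho alpha k ^+ 2.
  by rewrite sqrtCK opprB.
rewrite /transfer detZ exprVn.
suff -> : \det (if oddz k then mx22 (alpha k) z z^-1 (alpha k)^*
     else mx22 (alpha k)^* 1 1 (alpha k)) = - rho alpha k ^+ 2.
  by rewrite mulrN mulVf// expf_neq0.
rewrite -e; case: ifP => _; rewrite det_mx22 normCK ?divff// ?mulr1//.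
by rewrite mulrC.
Qed.

Lemma transfer_sol_init (R : realType) (alpha : int -> R[i]) (z : R[i])
    (k0 : int) (c : 'cV[R[i]]_2) :
  transfer_sol alpha z k0 c k0 = c.
Proof. by rewrite /transfer_sol subrr. Qed.

Lemma transfer_sol_rec (R : realType) (alpha : int -> R[i]) (z : R[i])
    (k0 : int) (c : 'cV[R[i]]_2) (k : int) :
  (forall j, `|alpha j| < 1) -> z != 0 ->
  transfer_sol alpha z k0 c k =
  transfer alpha z k *m transfer_sol alpha z k0 c (k - 1).
Proof.
move=> a1 z0; rewrite /transfer_sol addrAC.
have [[n ->]|[n ->]] :
    (exists n : nat, k = k0 + n.+1%:Z) \/ (exists n : nat, k = k0 - n%:Z).
  case: (ltrP k0 k) => h.
    by left; exists (`|k - k0|%N.-1); lia.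
  by right; exists `|k0 - k|%N; lia.
  have -> : k0 + n.+1%:Z - k0 = n.+1 by lia.
  by have -> : n.+1%:Z - 1 = n by lia.
have TK x : transfer alpha z (k0 - n%:Z) *m
    (invmx (transfer alpha z (k0 - n%:Z)) *m x) = x.
  by rewrite mulKVmx// unitmxE det_transfer// unitfE oppr_eq0 oner_eq0.
have -> : k0 - n%:Z - k0 = - n%:Z by lia.
have -> : - n%:Z - 1 = Negz n by lia.
rewrite iteriS /= TK.
by case: n {TK} => [//|n]; have -> : - n.+1%:Z = Negz n by lia.
Qed.

(* Main.v *)
(* The operators V and W are isometries of l^2(Z) with banded inverses, so that
   the resolvent of U = VW off the unit circle is a Neumann series, which is also
   the Taylor series of its entries at 0.  The transfer recursion for (u, v)
   encodes Wu = zv, Vv = u.  A nonzero solution that is l^2 at one end comes from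
   the resolvent of an operator decoupled between -1 and 0.  Comparing the norms
   of u and v over a half-line shows that (p_+, r_+) is not such a solution, so
   M_+ and M_- exist; they differ because an l^2 solution on Z would be an
   eigenvector of U.  The transfer matrices have determinant -1, so the Wronskian
   alternates, and the column built from the Weyl solutions is mapped by U - z to
   a basis vector. *)
Require Import Defs.
From HB Require Import structures.
From mathcomp Require Import all_boot all_order all_algebra.
From mathcomp Require Import all_classical all_reals all_analysis.
From mathcomp Require Import complex.
From mathcomp Require Import zify ring lra.
Import Order.TTheory GRing.Theory Num.Theory.
Import numFieldNormedType.Exports.
Local Open Scope classical_set_scope.
Local Open Scope ring_scope.

Set Implicit Arguments.
Unset Strict Implicit.
Unset Printing Implicit Defensive.

(** The blocks of V and W are staggered: a cut between k - 1 and k splits a block of exactly one of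
    them, namely [theta] k. On a half-line only the other operator acts as an isometry, which yields
    one of ||u|| = |z| ||v|| and ||v|| = ||u||; moving the cut by one index yields the other, and
    |z| <> 1 makes the two clash. The same staggering explains the parity rule on the diagonal of
    the Green function. Decoupling uses a coefficient of modulus 1, so the resolvent is built for
    |alpha_k| <= 1, whereas the transfer matrices need |alpha_k| < 1. Both [resolvent] and [weyl_M]
    are choices by [xget], hence existence has to precede every formula; a column of the resolvent
    is then identified by an l^2 solution g of (U - z) g = e_k'. *)

Lemma oddzD1 (k : int) : oddz (k + 1) = ~~ oddz k.
Proof. by rewrite /oddz; lia. Qed.

Lemma oddzB1 (k : int) : oddz (k - 1) = ~~ oddz k.
Proof. by rewrite /oddz; lia. Qed.

Lemma exprz_sign (K : unitRingType) (k : int) :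
  (-1 : K) ^ k = if oddz k then -1 else 1.
Proof.
case: k => n; first by rewrite -exprnP -signr_odd /oddz absz_nat; case: odd.
rewrite NegzE -invr_expz -exprnP -signr_odd /oddz.
by case: (odd n.+1); rewrite ?invrN invr1.
Qed.

Lemma mx22_mul_cv2 (K : pzRingType) (a b c d x y : K) :
  mx22 a b c d *m cv2 x y = cv2 (a * x + b * y) (c * x + d * y).
Proof.
apply/matrixP => i j; rewrite !mxE !big_ord_recl big_ord0 !mxE /= addr0.
by case: (i == 0).
Qed.

Lemma cv2E (K : Type) (x y : K) : (cv2 x y 0 0 = x) * (cv2 x y 1 0 = y).
Proof. by rewrite !mxE. Qed.

Lemma wronskian_cv2 (K : pzRingType) (a b c d : K) :
  wronskian (cv2 a b) (cv2 c d) = a * d - c * b.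
Proof. by rewrite /wronskian !cv2E. Qed.

Lemma ord2P (i : 'I_2) : i = 0 \/ i = 1.
Proof. by case: i => [[|[|?]] ?] //; [left|right]; apply: val_inj. Qed.

Lemma cv2_eta (K : Type) (x : 'cV[K]_2) : x = cv2 (x 0 0) (x 1 0).
Proof.
apply/matrixP => i j; rewrite !mxE (ord1 j).
by have [->|->] := ord2P i.
Qed.

(** * Square summable sequences *)

Lemma normc_sqrE (R : realType) (x : R[i]) :
  Normc.normc x ^+ 2 = complex.Re x ^+ 2 + complex.Im x ^+ 2.
Proof. by case: x => a b /=; rewrite sqr_sqrtr// addr_ge0// sqr_ge0. Qed.

Lemma normc_sqrC (R : realType) (x : R[i]) :
  (Normc.normc x ^+ 2)%:C%C = `|x| ^+ 2.
Proof. by rewrite normc_sqrE add_Re2_Im2. Qed.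

Lemma normcR (R : realType) (x : R[i]) : `|x| = (Normc.normc x)%:C%C.
Proof. by rewrite normc_def; case: x. Qed.

Lemma normc_ge0 (R : realType) (x : R[i]) : 0 <= Normc.normc x.
Proof. by case: x => a b /=; exact: sqrtr_ge0. Qed.

Lemma normc_sqrM (R : realType) (x y : R[i]) :
  Normc.normc (x * y) ^+ 2 = Normc.normc x ^+ 2 * Normc.normc y ^+ 2.
Proof. by rewrite Normc.normcM exprMn. Qed.

Lemma normc_sqr_eq0 (R : realType) (x : R[i]) :
  Normc.normc x ^+ 2 = 0 -> x = 0.
Proof. by move/eqP; rewrite sqrf_eq0 => /eqP/Normc.eq0_normc. Qed.

(* Convexity of the square, with weights [1 - r] and [r]. *)
Lemma normc_sqrD_le (R : realType) (r : R) (x y : R[i]) : 0 < r < 1 ->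
  Normc.normc (x + y) ^+ 2 <=
  (1 - r)^-1 * Normc.normc x ^+ 2 + r^-1 * Normc.normc y ^+ 2.
Proof.
move=> /andP[r0 r1]; rewrite !normc_sqrE.
have H (a b : R) : (a + b) ^+ 2 <= (1 - r)^-1 * a ^+ 2 + r^-1 * b ^+ 2.
  rewrite -subr_ge0.
  have -> : (1 - r)^-1 * a ^+ 2 + r^-1 * b ^+ 2 - (a + b) ^+ 2 =
      (r * a - (1 - r) * b) ^+ 2 / (r * (1 - r)).
    by field; rewrite !gt_eqF// subr_gt0.
  by rewrite divr_ge0 ?sqr_ge0// mulr_ge0 ?subr_ge0// ltW.
case: x y => [a b] [c d] /=.
by have := H a c; have := H b d; lra.
Qed.

Lemma normc_sqr_ge0 (R : realType) (x : R[i]) :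
  (0 <= (Normc.normc x ^+ 2)%:E)%E.
Proof. by rewrite lee_fin sqr_ge0. Qed.
Lemma sqnorm_ge0 (R : realType) (D : set int) (f : int -> R[i]) :
  (0 <= sqnorm D f)%E.
Proof. by apply: esum_ge0 => k _; exact: normc_sqr_ge0. Qed.

Lemma esumZl (R : realType) (T : choiceType) (D : set T) (a : T -> \bar R)
    (c : R) : 0 <= c -> (forall i, 0 <= a i)%E ->
  \esum_(i in D) (c%:E * a i)%E = (c%:E * \esum_(i in D) a i)%E.
Proof.
move=> c0 a0; rewrite /esum -ereal_supZl//; last first.
  apply/set0P; exists (\sum_(i \in set0) a i); exists set0 => //.
  exact: fsets_set0.
congr ereal_sup; apply/seteqP; split => x /=.
  move=> [X FX <-]; exists (\sum_(i \in X) a i); first by exists X.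
  by rewrite ge0_mule_fsumr.
by move=> [_ [X FX <-] <-]; exists X => //; rewrite ge0_mule_fsumr.
Qed.

Lemma sqnormZ (R : realType) (D : set int) (c : R[i]) (f : int -> R[i]) :
  sqnorm D (c *: f) = ((Normc.normc c ^+ 2)%:E * sqnorm D f)%E.
Proof.
rewrite /sqnorm -esumZl ?sqr_ge0//; last by move=> k; exact: normc_sqr_ge0.
by apply: eq_esum => k _; rewrite -EFinM -normc_sqrM.
Qed.

Lemma sqnormD_le (R : realType) (r : R) (D : set int) (f g : int -> R[i]) :
  0 < r < 1 ->
  (sqnorm D (f + g)%R <=
   ((1 - r)^-1)%:E * sqnorm D f + (r^-1)%:E * sqnorm D g)%E.
Proof.
move=> r01; have /andP[r0 r1] := r01.
have n0 (h : int -> R[i]) k := normc_sqr_ge0 (h k).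
have c0 : 0 <= (1 - r)^-1 by rewrite invr_ge0 subr_ge0 ltW.
have c1 : 0 <= r^-1 by rewrite invr_ge0 ltW.
rewrite /sqnorm -!esumZl// -esumD; try by move=> k _; rewrite mule_ge0.
by apply: le_esum => k _; rewrite -!EFinM -EFinD lee_fin; exact: normc_sqrD_le.
Qed.

Lemma le_sqnorm (R : realType) (D E : set int) (f : int -> R[i]) :
  D `<=` E -> (sqnorm D f <= sqnorm E f)%E.
Proof.
move=> DE; rewrite /sqnorm esum_mkcond [leRHS]esum_mkcond.
apply: le_esum => k _; case: ifPn => [|_].
  by rewrite inE => /DE; rewrite -in_setE => ->.
by case: ifP => // _; exact: normc_sqr_ge0.
Qed.

Lemma sqnorm_set1 (R : realType) (k : int) (f : int -> R[i]) :
  sqnorm [set k] f = (Normc.normc (f k) ^+ 2)%:E.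
Proof. by rewrite /sqnorm esum_set1//; exact: normc_sqr_ge0. Qed.

Lemma le_term_sqnorm (R : realType) (D : set int) (f : int -> R[i]) (k : int) :
  D k -> ((Normc.normc (f k) ^+ 2)%:E <= sqnorm D f)%E.
Proof. by move=> Dk; rewrite -sqnorm_set1 le_sqnorm// => _ ->. Qed.

Lemma sqnorm_eq0 (R : realType) (D : set int) (f : int -> R[i]) (k : int) :
  sqnorm D f = 0%E -> D k -> f k = 0.
Proof.
move=> f0 /(@le_term_sqnorm _ _ f); rewrite f0 lee_fin => fk.
by apply: normc_sqr_eq0; apply/eqP; rewrite eq_le fk sqr_ge0.
Qed.

Lemma eq_sqnorm (R : realType) (D : set int) (f g : int -> R[i]) :
  (forall k, D k -> f k = g k) -> sqnorm D f = sqnorm D g.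
Proof. by move=> fg; apply: eq_esum => k /fg ->. Qed.

Lemma sqnormID (R : realType) (E D : set int) (f : int -> R[i]) :
  sqnorm D f = (sqnorm (D `&` E) f + sqnorm (D `&` ~` E) f)%E.
Proof. by rewrite /sqnorm (esumID E)// => k _; exact: normc_sqr_ge0. Qed.

Lemma l2W (R : realType) (D E : set int) (f : int -> R[i]) :
  D `<=` E -> l2 E f -> l2 D f.
Proof. by move=> DE; apply: le_lt_trans; exact: le_sqnorm. Qed.

Lemma l2U (R : realType) (D E : set int) (f : int -> R[i]) :
  l2 D f -> l2 E f -> l2 (D `|` E) f.
Proof.
move=> lD lE; rewrite /l2 (sqnormID D) lte_add_pinfty//.
- by apply: l2W lD => k [].
- by apply: l2W lE => k [[]].
Qed.

Lemma eq_l2 (R : realType) (D : set int) (f g : int -> R[i]) :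
  (forall k, D k -> f k = g k) -> l2 D f -> l2 D g.
Proof. by rewrite /l2 => /eq_sqnorm ->. Qed.

Lemma l2Z (R : realType) (D : set int) (c : R[i]) (f : int -> R[i]) :
  l2 D f -> l2 D (c *: f).
Proof. by move=> lf; rewrite /l2 sqnormZ lte_mul_pinfty// lee_fin sqr_ge0. Qed.

Lemma l2D (R : realType) (D : set int) (f g : int -> R[i]) :
  l2 D f -> l2 D g -> l2 D (f + g).
Proof.
move=> lf lg; have h : 0 < (2^-1 : R) < 1 by lra.
apply: le_lt_trans (sqnormD_le D f g h) _.
by rewrite lte_add_pinfty// lte_mul_pinfty// lee_fin invr_ge0; lra.
Qed.

Lemma l2_set1 (R : realType) (k : int) (f : int -> R[i]) : l2 [set k] f.
Proof. by rewrite /l2 sqnorm_set1 ltry. Qed.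

Lemma sqnorm0 (R : realType) (D : set int) (f : int -> R[i]) :
  (forall k, D k -> f k = 0) -> sqnorm D f = 0%E.
Proof.
by move=> f0; apply: esum1 => k /f0 ->; rewrite Normc.normc0 expr0n.
Qed.

Lemma l2_0 (R : realType) (D : set int) (f : int -> R[i]) :
  (forall k, D k -> f k = 0) -> l2 D f.
Proof. by move=> f0; rewrite /l2 sqnorm0// ltry. Qed.

Lemma l2_basis (R : realType) (k : int) : l2 setT (@basis_vector R k).
Proof.
rewrite -(setUv [set k]); apply: l2U; first exact: l2_set1.
by apply: l2_0 => j /= /eqP jk; rewrite /basis_vector (negbTE jk).
Qed.

(** * Block diagonal operators *)

Lemma rho_sqr (R : realType) (alpha : int -> R[i]) (k : int) :
  rho alpha k ^+ 2 = 1 - alpha k * (alpha k)^*.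
Proof. by rewrite sqrtCK normCK. Qed.

Lemma conj_rho (R : realType) (alpha : int -> R[i]) (k : int) :
  `|alpha k| <= 1 -> (rho alpha k)^* = rho alpha k.
Proof.
move=> a1; apply/CrealP/ger0_real.
by rewrite sqrtC_ge0 subr_ge0 expr_le1.
Qed.

Lemma block_opE (R : realType) (alpha : int -> R[i]) (b : bool)
    (f : int -> R[i]) (j : int) :
  block_op alpha b f j =
  if oddz j == b then rho alpha j * f (j - 1) + (alpha j)^* * f j
  else - alpha (j + 1) * f j + rho alpha (j + 1) * f (j + 1).
Proof. by rewrite /block_op /theta !mx22_mul_cv2 !cv2E. Qed.

Lemma seq_linE (R : realType) (c : R[i]) (f g : int -> R[i]) (j : int) :
  (c *: f + g) j = c * f j + g j.
Proof. by []. Qed.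

Lemma block_op_linear (R : realType) (alpha : int -> R[i]) (b : bool)
    (c : R[i]) (f g : int -> R[i]) :
  block_op alpha b (c *: f + g) = c *: block_op alpha b f + block_op alpha b g.
Proof.
apply/funext => j; rewrite seq_linE !block_opE !seq_linE.
by case: ifP => _; ring.
Qed.

(* A set of indices that is a union of blocks of [block_op alpha b]. *)
Definition blocked (b : bool) (D : set int) : Prop :=
  forall j, oddz j = b -> (D (j - 1) <-> D j).

Lemma blockedT b : blocked b setT.
Proof. by []. Qed.

(** No block may straddle the end of the half-line. A cut just before j splits the block [theta] j,
    with j = [k] on the right and j = [k + 1] on the left, so the admissible parity is the one
    opposite to j. *)
Lemma blocked_half_line (s : bool) (k : int) :
  blocked (s (+) oddz k) (half_line s k).
Proof.
move=> j; rewrite /half_line; case: s => /=; rewrite /oddz; first by lia.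
by lia.
Qed.

(** Indices of parity [b] are the second ones of their blocks; as [D] contains blocks whole, j |-> j
    - 1 carries those in [D] bijectively onto the first ones. *)
Lemma sqnorm_blocks (R : realType) (b : bool) (D : set int)
    (f : int -> R[i]) : blocked b D ->
  sqnorm D f = \esum_(j in D `&` [set j | oddz j = b])
    ((Normc.normc (f (j - 1)) ^+ 2)%:E + (Normc.normc (f j) ^+ 2)%:E)%E.
Proof.
move=> bD; rewrite esumD; try by move=> k _; exact: normc_sqr_ge0.
rewrite (sqnormID [set j | oddz j = b]) addeC; congr (_ + _)%E.
rewrite /sqnorm; apply: (@reindex_esum _ _ _ _ _ (fun j : int => j - 1)).
split => [j /= [Dj jb]|i j _ _ /=|j /= [Dj jb]].
- by split; [apply/bD|rewrite oddzB1 jb; case: (b)].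
- by move/addIr.
- have jb' : oddz (j + 1) = b by rewrite oddzD1; case: (oddz j) (b) jb => [] [].
  by exists (j + 1); [split=> //; apply/(bD _ jb')|]; rewrite addrK.
Qed.

(** Each block is unitary: the bound on [alpha] makes [rho] real, after which the conjugates are
    treated as independent variables and rho^2 = 1 - alpha conj(alpha) is the only relation used.
    Modulus 1 is allowed for the sake of the decoupled operator. *)
Lemma sqnorm_block_op (R : realType) (alpha : int -> R[i]) (b : bool)
    (D : set int) (f : int -> R[i]) :
  (forall k, `|alpha k| <= 1) -> blocked b D ->
  sqnorm D (block_op alpha b f) = sqnorm D f.
Proof.
move=> a1 bD; rewrite !(sqnorm_blocks _ bD); apply: eq_esum => j [_ /= jb].
have jb' : (oddz (j - 1) == b) = false by rewrite oddzB1 -jb; case: (oddz j).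
rewrite -!EFinD; congr EFin; apply: complexI.
rewrite !rmorphD /= !normc_sqrC !block_opE jb' jb eqxx subrK !normCK.
rewrite !(rmorphD, rmorphM, rmorphN) /= conjCK conj_rho//.
have := rho_sqr alpha j; move: (rho alpha j) => r.
move: (alpha j) (alpha j)^* (f j) (f j)^* (f (j - 1)) (f (j - 1))^*.
move=> a a' y y' x x' h; ring: h.
Qed.

(** [theta] is symmetric, so the adjoint of a unitary block is its entrywise conjugate, which is
    again a [theta], with the conjugate coefficient. The inverses of V and W are thus block
    operators too. *)
Definition conjseq (R : realType) (alpha : int -> R[i]) : int -> R[i] :=
  fun k => (alpha k)^*.

Lemma rho_conjseq (R : realType) (alpha : int -> R[i]) k :
  rho (conjseq alpha) k = rho alpha k.
Proof. by rewrite /rho /conjseq norm_conjC. Qed.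

Lemma block_opK (R : realType) (alpha : int -> R[i]) (b : bool)
    (f : int -> R[i]) :
  block_op (conjseq alpha) b (block_op alpha b f) = f.
Proof.
apply/funext => j; rewrite block_opE !rho_conjseq /conjseq conjCK.
have := rho_sqr alpha j; have := rho_sqr alpha (j + 1).
case: (oddz j == b) / eqP => jb h1 h2.
  have jb' : (oddz (j - 1) == b) = false by rewrite oddzB1 -jb; case: (oddz j).
  rewrite !block_opE jb jb' eqxx subrK; ring: h2.
have jb' : oddz (j + 1) == b by rewrite oddzD1; case: (oddz j) (b) jb => [] [].
rewrite !block_opE jb' (negbTE (introN eqP jb)) addrK; ring: h1.
Qed.

Lemma conjseqK (R : realType) (alpha : int -> R[i]) :
  conjseq (conjseq alpha) = alpha.
Proof. by apply/funext => k; rewrite /conjseq conjCK. Qed.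

Lemma block_op_conjK (R : realType) (alpha : int -> R[i]) (b : bool)
    (f : int -> R[i]) :
  block_op alpha b (block_op (conjseq alpha) b f) = f.
Proof. by rewrite -{1}(conjseqK alpha) block_opK. Qed.

Definition cmvUinv (R : realType) (alpha : int -> R[i]) : operator R :=
  fun f => cmvW (conjseq alpha) (cmvV (conjseq alpha) f).

Lemma cmvUK (R : realType) (alpha : int -> R[i]) f :
  cmvUinv alpha (cmvU alpha f) = f.
Proof. by rewrite /cmvUinv /cmvU /cmvV /cmvW !block_opK. Qed.

Lemma cmvUinvK (R : realType) (alpha : int -> R[i]) f :
  cmvU alpha (cmvUinv alpha f) = f.
Proof. by rewrite /cmvUinv /cmvU /cmvV /cmvW !block_op_conjK. Qed.

(** * Convergence of complex sequences *)

(** Componentwise, so that comparison and limit theorems for real sequences apply. *)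
Definition ccvg (R : realType) (x : nat -> R[i]) (l : R[i]) : Prop :=
  (complex.Re (x n) @[n --> \oo] --> complex.Re l) /\
  (complex.Im (x n) @[n --> \oo] --> complex.Im l).

Lemma ccvg_cst (R : realType) (l : R[i]) : ccvg (fun=> l) l.
Proof. by split; exact: cvg_cst. Qed.

Lemma ReD (R : realType) (x y : R[i]) :
  complex.Re (x + y) = complex.Re x + complex.Re y.
Proof. by case: x y => [? ?] []. Qed.

Lemma ImD (R : realType) (x y : R[i]) :
  complex.Im (x + y) = complex.Im x + complex.Im y.
Proof. by case: x y => [? ?] []. Qed.

Lemma ReM (R : realType) (x y : R[i]) : complex.Re (x * y) =
  complex.Re x * complex.Re y - complex.Im x * complex.Im y.
Proof. by case: x y => [? ?] []. Qed.

Lemma ImM (R : realType) (x y : R[i]) : complex.Im (x * y) =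
  complex.Re x * complex.Im y + complex.Im x * complex.Re y.
Proof. by case: x y => [? ?] [] ? ? /=; ring. Qed.

Lemma ccvgD (R : realType) (x y : nat -> R[i]) (l m : R[i]) :
  ccvg x l -> ccvg y m -> ccvg (fun n => x n + y n) (l + m).
Proof.
move=> [xr xi] [yr yi]; split; rewrite ?ReD ?ImD.
  by under eq_cvg do rewrite ReD; exact: cvgD.
by under eq_cvg do rewrite ImD; exact: cvgD.
Qed.

Lemma ccvgZ (R : realType) (c : R[i]) (x : nat -> R[i]) (l : R[i]) :
  ccvg x l -> ccvg (fun n => c * x n) (c * l).
Proof.
move=> [xr xi]; split; rewrite ?ReM ?ImM.
  under eq_cvg do rewrite ReM.
  by apply: cvgB; apply: cvgM => //; exact: cvg_cst.
under eq_cvg do rewrite ImM.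
by apply: cvgD; apply: cvgM => //; exact: cvg_cst.
Qed.

Lemma ccvg_unique (R : realType) (x : nat -> R[i]) (l m : R[i]) :
  ccvg x l -> ccvg x m -> l = m.
Proof.
move=> [lr li] [mr mi]; apply/eqP; rewrite eq_complex; apply/andP.
by split; apply/eqP; [move: lr mr|move: li mi]; apply: cvg_unique;
  exact: norm_hausdorff.
Qed.

Lemma ccvg_shift (R : realType) (x : nat -> R[i]) (l : R[i]) :
  ccvg (fun n => x n.+1) l <-> ccvg x l.
Proof.
have sR := cvg_shiftS (fun n => complex.Re (x n)) (nbhs (complex.Re l)).
have sI := cvg_shiftS (fun n => complex.Im (x n)) (nbhs (complex.Im l)).
split=> -[xr xi]; split.
- by rewrite -sR.
- by rewrite -sI.
- by rewrite sR.
- by rewrite sI.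
Qed.

Lemma ccvg_normc_sqr (R : realType) (x : nat -> R[i]) (l : R[i]) :
  ccvg x l -> Normc.normc (x n) ^+ 2 @[n --> \oo] --> Normc.normc l ^+ 2.
Proof.
move=> [xr xi]; rewrite normc_sqrE; under eq_cvg do rewrite normc_sqrE !expr2.
by rewrite !expr2; apply: cvgD; exact: cvgM.
Qed.

Lemma normr_Re_le (R : realType) (x : R[i]) :
  `|complex.Re x| <= Normc.normc x.
Proof.
case: x => a b /=; rewrite -sqrtr_sqr ler_wsqrtr// lerDl; exact: sqr_ge0.
Qed.

Lemma normr_Im_le (R : realType) (x : R[i]) :
  `|complex.Im x| <= Normc.normc x.
Proof.
case: x => a b /=; rewrite -sqrtr_sqr ler_wsqrtr// lerDr; exact: sqr_ge0.
Qed.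

(** A form of Fatou's lemma: the norm is a supremum of finite sums, and each finite sum passes to
    the limit. *)
Lemma sqnorm_lim_le (R : realType) (D : set int) (F : nat -> int -> R[i])
    (f : int -> R[i]) (C : R) :
  (forall j, ccvg (F^~ j) (f j)) -> (forall n, sqnorm D (F n) <= C%:E)%E ->
  (sqnorm D f <= C%:E)%E.
Proof.
move=> Ff FC; apply: ge_ereal_sup => _ [X [finX XD] <-].
rewrite fsbig_finite//= sumEFin lee_fin.
have cvS (s : seq int) : \sum_(i <- s) Normc.normc (F n i) ^+ 2 @[n --> \oo] -->
    \sum_(i <- s) Normc.normc (f i) ^+ 2.
  elim: s => [|i s IH].
    by rewrite big_nil; under eq_cvg do rewrite big_nil; exact: cvg_cst.
  rewrite big_cons; under eq_cvg do rewrite big_cons.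
  by apply: cvgD => //; exact: ccvg_normc_sqr.
rewrite -(cvg_lim _ (cvS _))//; apply: limr_le.
  by apply/cvg_ex; eexists; exact: cvS.
apply: nearW => n; rewrite -lee_fin -sumEFin -fsbig_finite//.
apply: le_trans (FC n).
by apply: ereal_sup_ubound; exists X.
Qed.

(** * Neumann series *)

(* Pointwise continuity holds for operators with a banded matrix; it replaces
   the completeness of l^2 in the convergence of the Neumann series. *)
Definition local_isometry (R : realType) (A : operator R) : Prop :=
  [/\ forall c f g, A (c *: f + g) = c *: A f + A g,
      forall f, sqnorm setT (A f) = sqnorm setT f &
      forall (F : nat -> int -> R[i]) f, (forall j, ccvg (F^~ j) (f j)) ->
        forall j, ccvg (fun n => A (F n) j) (A f j)].

Lemma local_isometry_comp (R : realType) (A B : operator R) :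
  local_isometry A -> local_isometry B -> local_isometry (A \o B).
Proof.
move=> [lA iA cA] [lB iB cB]; split=> [c f g|f|F f Ff] /=.
- by rewrite lB lA.
- by rewrite iA iB.
- by apply: cA; exact: cB.
Qed.

Lemma local_isometry_block_op (R : realType) (alpha : int -> R[i]) (b : bool) :
  (forall k, `|alpha k| <= 1) -> local_isometry (block_op alpha b).
Proof.
move=> a1; split=> [c f g|f|F f Ff j]; first exact: block_op_linear.
  by apply: sqnorm_block_op => //; exact: blockedT.
rewrite block_opE; under [X in ccvg X]eq_fun do rewrite block_opE.
by case: ifP => _; apply: ccvgD; exact: ccvgZ.
Qed.

Lemma local_isometry_cmvU (R : realType) (alpha : int -> R[i]) :
  (forall k, `|alpha k| <= 1) -> local_isometry (cmvU alpha).
Proof.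
by move=> a1; apply: local_isometry_comp; exact: local_isometry_block_op.
Qed.

Lemma conjseq_le1 (R : realType) (alpha : int -> R[i]) :
  (forall k, `|alpha k| <= 1) -> forall k, `|conjseq alpha k| <= 1.
Proof. by move=> a1 k; rewrite norm_conjC. Qed.

Lemma local_isometry_cmvUinv (R : realType) (alpha : int -> R[i]) :
  (forall k, `|alpha k| <= 1) -> local_isometry (cmvUinv alpha).
Proof.
move=> /conjseq_le1 a1.
by apply: local_isometry_comp; exact: local_isometry_block_op.
Qed.

Section LinearOperator.
Context (R : realType) (A : operator R).
Hypothesis linA : forall c f g, A (c *: f + g) = c *: A f + A g.

Lemma opD f g : A (f + g) = A f + A g.
Proof. by have := linA 1 f g; rewrite !scale1r. Qed.

Lemma op0 : A 0 = 0.
Proof. by apply: (@addrI _ (A 0)); rewrite -opD !addr0. Qed.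

Lemma opZ c f : A (c *: f) = c *: A f.
Proof. by have := linA c f 0; rewrite op0 !addr0. Qed.

End LinearOperator.

Lemma l2_sqnorm (R : realType) (D : set int) (f : int -> R[i]) :
  l2 D f -> exists2 C : R, 0 <= C & sqnorm D f = (C ^+ 2)%:E.
Proof.
move=> lf; have fin : sqnorm D f \is a fin_num.
  by rewrite ge0_fin_numE// sqnorm_ge0.
exists (Num.sqrt (fine (sqnorm D f))); first exact: sqrtr_ge0.
by rewrite sqr_sqrtr ?fineK// fine_ge0// sqnorm_ge0.
Qed.

Section Neumann.
Context (R : realType) (A : operator R) (w : R[i]).
Hypothesis A_iso : local_isometry A.

Let linA : forall c f g, A (c *: f + g) = c *: A f + A g.
Proof. by case: A_iso. Qed.

Definition neumann_term (n : nat) (f : int -> R[i]) : int -> R[i] :=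
  iter n (fun g => w *: A g) f.

(** Horner form of the partial sums of (w A)^n f: the fixed point equation of the limit is then the
    limit of the recursion itself. *)
Definition neumann_sum (n : nat) (f : int -> R[i]) : int -> R[i] :=
  iter n (fun g => f + w *: A g) 0.

Lemma neumann_sum_recl n f :
  neumann_sum n.+1 f = f + w *: A (neumann_sum n f).
Proof. by []. Qed.

Lemma neumann_term_recl n f : neumann_term n.+1 f = w *: A (neumann_term n f).
Proof. by []. Qed.

Lemma neumann_sum_recr n f :
  neumann_sum n.+1 f = neumann_sum n f + neumann_term n f.
Proof.
elim: n => [|n IH].
  by rewrite neumann_sum_recl (op0 linA) scaler0 addr0 add0r.
by rewrite neumann_sum_recl {1}IH (opD linA) scalerDr addrA.
Qed.

Lemma neumann_sum_linear n c f g :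
  neumann_sum n (c *: f + g) = c *: neumann_sum n f + neumann_sum n g.
Proof.
elim: n => [|n IH]; first by rewrite /= scaler0 addr0.
rewrite !neumann_sum_recl IH linA !scalerDr !scalerA [w * c]mulrC.
by rewrite addrACA.
Qed.

Lemma neumann_sum_telescope n f :
  neumann_sum n (f - w *: A f) = f - neumann_term n f.
Proof.
elim: n => [|n IH]; first by rewrite /= subrr.
rewrite neumann_sum_recl IH (opD linA) -(scaleN1r (neumann_term n f)).
rewrite (opZ linA).
by rewrite scaleN1r scalerDr scalerN addrA subrK neumann_term_recl.
Qed.

Lemma sqnorm_neumann_term n f :
  sqnorm setT (neumann_term n f) =
  (((Normc.normc w ^+ 2) ^+ n)%:E * sqnorm setT f)%E.
Proof.
have [_ isoA _] := A_iso.
elim: n => [|n IH]; first by rewrite expr0 mul1e.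
by rewrite neumann_term_recl sqnormZ isoA IH (exprS _ n) muleA -EFinM.
Qed.

Lemma normc_neumann_term_le n f C j : 0 <= C ->
  sqnorm setT f = (C ^+ 2)%:E ->
  Normc.normc (neumann_term n f j) <= C * Normc.normc w ^+ n.
Proof.
move=> C0 fC.
rewrite -(@ler_pXn2r _ 2)// ?nnegrE ?normc_ge0 ?mulr_ge0 ?exprn_ge0 ?normc_ge0//.
have := le_term_sqnorm (neumann_term n f) (I : setT j).
by rewrite sqnorm_neumann_term fC -EFinM lee_fin exprAC mulrC -exprMn.
Qed.

(** [phi] stands for the real or the imaginary part, so that both are handled at once. *)
Lemma series_neumann (phi : R[i] -> R) f j :
  phi 0 = 0 -> (forall x y, phi (x + y) = phi x + phi y) ->
  (fun n => phi (neumann_sum n f j)) =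
  series (fun n => phi (neumann_term n f j)).
Proof.
move=> phi0 phiD; apply/funext; elim=> [|n IH].
  by rewrite /series /= big_geq.
rewrite neumann_sum_recr phiD IH.
by rewrite /series /= big_nat_recr.
Qed.

Hypothesis w_lt1 : Normc.normc w < 1.

Lemma is_cvg_neumann (phi : R[i] -> R) f j :
  phi 0 = 0 -> (forall x y, phi (x + y) = phi x + phi y) ->
  (forall x, `|phi x| <= Normc.normc x) -> l2 setT f ->
  cvgn (fun n => phi (neumann_sum n f j)).
Proof.
move=> phi0 phiD phi_le /l2_sqnorm[C C0 fC].
rewrite series_neumann//; apply: normed_cvg.
apply: (@series_le_cvg _ _ (geometric C (Normc.normc w))) => [n|n|n|].
- exact: normr_ge0.
- by rewrite mulr_ge0// exprn_ge0// normc_ge0.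
- exact: le_trans (phi_le _) (normc_neumann_term_le _ _ C0 fC).
- by apply: is_cvg_geometric_series; rewrite ger0_norm ?normc_ge0.
Qed.

Definition neumann (f : int -> R[i]) : int -> R[i] := fun j =>
  Complex (limn (fun n => complex.Re (neumann_sum n f j)))
          (limn (fun n => complex.Im (neumann_sum n f j))).

Lemma neumann_ccvg f j : l2 setT f ->
  ccvg (fun n => neumann_sum n f j) (neumann f j).
Proof.
move=> lf; split.
  by apply: is_cvg_neumann => //; [exact: ReD|exact: normr_Re_le].
by apply: is_cvg_neumann => //; [exact: ImD|exact: normr_Im_le].
Qed.

Lemma neumann_linear c f g : l2 setT f -> l2 setT g ->
  neumann (c *: f + g) = c *: neumann f + neumann g.
Proof.
move=> lf lg; apply/funext => j.
apply: (@ccvg_unique _ (fun n => neumann_sum n (c *: f + g) j)).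
  by apply: neumann_ccvg; apply: l2D => //; apply: l2Z.
under [X in ccvg X]eq_fun do rewrite neumann_sum_linear seq_linE.
by rewrite seq_linE; apply: ccvgD; [apply: ccvgZ|]; exact: neumann_ccvg.
Qed.

Lemma neumann_fix f : l2 setT f -> neumann f = f + w *: A (neumann f).
Proof.
move=> lf; have [_ _ cA] := A_iso; apply/funext => j.
apply: (@ccvg_unique _ (fun n => neumann_sum n.+1 f j)).
  apply: (ccvg_shift (fun n => neumann_sum n f j) _).2.
  exact: neumann_ccvg.
apply: (ccvgD (ccvg_cst (f j))); apply: ccvgZ; apply: cA => i.
exact: neumann_ccvg.
Qed.

(** The constant reproduces itself in the recursion: with weights 1 - r and r in the convexity
    bound, C / (1 - r) + r^-1 r^2 C / (1 - r)^2 = C / (1 - r)^2. *)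
Lemma sqnorm_neumann_sum_le n f C r : 0 < r < 1 -> Normc.normc w <= r ->
  sqnorm setT f = C%:E ->
  (sqnorm setT (neumann_sum n f) <= ((1 - r)^-1 ^+ 2 * C)%:E)%E.
Proof.
move=> r01 wr fC; have [_ isoA _] := A_iso; have /andP[r0 r1] := r01.
have C0 : 0 <= C by rewrite -lee_fin -fC sqnorm_ge0.
have r1' : 0 < 1 - r by lra.
elim: n => [|n IH].
  by rewrite sqnorm0// lee_fin mulr_ge0// exprn_ge0// invr_ge0 ltW.
rewrite neumann_sum_recl; apply: le_trans (sqnormD_le _ _ _ r01) _.
rewrite sqnormZ isoA fC.
have wr2 : Normc.normc w ^+ 2 <= r ^+ 2.
  by rewrite ler_pXn2r// nnegrE ?normc_ge0// ltW.
apply: (@le_trans _ _ (((1 - r)^-1)%:E * C%:E + (r^-1)%:E *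
    ((r ^+ 2)%:E * ((1 - r)^-1 ^+ 2 * C)%:E)))%E.
  rewrite leeD2l// lee_pmul2l ?fin_numE// ?lte_fin ?invr_gt0//.
  by apply: lee_pmul => //; rewrite ?lee_fin ?sqr_ge0// sqnorm_ge0.
rewrite -!EFinM -EFinD lee_fin le_eqVlt; apply/orP; left; apply/eqP.
by field; rewrite !gt_eqF.
Qed.

Lemma sqnorm_neumann_le : exists K : R, forall f, l2 setT f ->
  (sqnorm setT (neumann f) <= K%:E * sqnorm setT f)%E.
Proof.
have [r r01 wr] : exists2 r : R, 0 < r < 1 & Normc.normc w <= r.
  move: (Normc.normc w : R) w_lt1 (normc_ge0 w) => x x1 x0.
  (* The midpoint of |w| and 1, since r serves as a weight and must be positive even when w = 0. *)
  by exists ((x + 1) / 2); lra.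
exists ((1 - r)^-1 ^+ 2) => f lf; have [C C0 fC] := l2_sqnorm lf.
rewrite fC -EFinM; apply: (@sqnorm_lim_le _ _ (fun n => neumann_sum n f)).
  by move=> j; exact: neumann_ccvg.
by move=> n; exact: sqnorm_neumann_sum_le.
Qed.

Lemma neumann_term_ccvg0 f j :
  l2 setT f -> ccvg (fun n => neumann_term n f j) 0.
Proof.
move=> /l2_sqnorm[C C0 fC].
have H (phi : R[i] -> R) : (forall x, `|phi x| <= Normc.normc x) ->
    phi (neumann_term n f j) @[n --> \oo] --> 0.
  move=> phi_le; apply/norm_cvg0P.
  apply: (squeeze_cvgr (f := fun=> 0) (h := geometric C (Normc.normc w))).
  - apply: nearW => n; rewrite normr_ge0/=.
    exact: le_trans (phi_le _) (normc_neumann_term_le _ _ C0 fC).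
  - exact: cvg_cst.
  - by apply: cvg_geometric; rewrite ger0_norm ?normc_ge0.
by split; apply: H; [exact: normr_Re_le|exact: normr_Im_le].
Qed.

Lemma neumann_opK f : l2 setT f -> neumann (f - w *: A f) = f.
Proof.
move=> lf; have [_ isoA _] := A_iso; apply/funext => j.
apply: (@ccvg_unique _ (fun n => neumann_sum n (f - w *: A f) j)).
  apply: neumann_ccvg; apply: l2D => //; rewrite -scaleNr.
  by apply: l2Z; rewrite /l2 isoA.
under [X in ccvg X]eq_fun do rewrite neumann_sum_telescope.
rewrite -[X in ccvg _ X]addr0 -[X in ccvg _ (_ + X)](mulr0 (-1)).
under [X in ccvg X]eq_fun do rewrite -scaleN1r.
apply: (ccvgD (ccvg_cst (f j))); apply: ccvgZ; exact: neumann_term_ccvg0.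
Qed.

End Neumann.

Lemma neumann_inverse (R : realType) (A : operator R) (w : R[i]) :
  local_isometry A -> Normc.normc w < 1 -> exists G : operator R,
  [/\ bounded_linear G,
      forall f, l2 setT f -> G f - w *: A (G f) = f &
      forall f, l2 setT f -> G (f - w *: A f) = f].
Proof.
move=> A_iso w1; exists (neumann A w); split.
- split; last exact: sqnorm_neumann_le.
  by move=> c f g; exact: neumann_linear.
- by move=> f lf; rewrite {1}neumann_fix// addrK.
- by move=> f lf; exact: neumann_opK.
Qed.

(** * The resolvent of U *)

Lemma bounded_linear_l2 (R : realType) (G : operator R) f :
  bounded_linear G -> l2 setT f -> l2 setT (G f).
Proof.
move=> [_ [K GK]] lf; apply: (le_lt_trans (GK f lf)).
have [C C0 ->] := l2_sqnorm lf.
by rewrite -EFinM ltry.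
Qed.

Lemma bounded_linear_comp (R : realType) (G H : operator R) :
  bounded_linear G -> bounded_linear H -> bounded_linear (G \o H).
Proof.
move=> bG bH; have [[lG [K GK]] [lH [L HL]]] := (bG, bH).
split=> [c f g lf lg|].
  by rewrite /= lH// lG//; exact: bounded_linear_l2.
exists (Num.max K 0 * L) => f lf.
apply: (le_trans (GK _ (bounded_linear_l2 bH lf))).
apply: (@le_trans _ _ ((Num.max K 0)%:E * sqnorm setT (H f)))%E.
  by apply: lee_wpmul2r; rewrite ?sqnorm_ge0// lee_fin le_max lexx.
rewrite EFinM -muleA; apply: lee_wpmul2l (HL f lf).
by rewrite lee_fin le_max lexx orbT.
Qed.

Lemma bounded_linear_scale (R : realType) (c : R[i]) :
  bounded_linear (fun f : int -> R[i] => c *: f).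
Proof.
split=> [d f g _ _|]; first by rewrite scalerDr !scalerA mulrC.
by exists (Normc.normc c ^+ 2) => f _; rewrite sqnormZ.
Qed.

Lemma local_isometry_bounded (R : realType) (A : operator R) :
  local_isometry A -> bounded_linear A.
Proof.
move=> [lA iA _]; split=> [c f g _ _|]; first exact: lA.
by exists 1 => f _; rewrite iA mul1e.
Qed.

Lemma near0_norm_lt1 (K : numFieldType) : \forall z \near (0 : K), `|z| < 1.
Proof. exact: nbhs0_lt. Qed.

Section Resolvent.
Context (R : realType) (alpha : int -> R[i]).
Hypothesis alpha_le1 : forall k, `|alpha k| <= 1.

Let U_iso := local_isometry_cmvU alpha_le1.
Let Uinv_iso := local_isometry_cmvUinv alpha_le1.
Let linU : forall c f g,
  cmvU alpha (c *: f + g) = c *: cmvU alpha f + cmvU alpha g.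
Proof. by case: U_iso. Qed.
Let linUinv : forall c f g,
  cmvUinv alpha (c *: f + g) = c *: cmvUinv alpha f + cmvUinv alpha g.
Proof. by case: Uinv_iso. Qed.

(** From U - z = U (1 - z U^-1). The case z = 0 is included. *)
Lemma cmvU_resolvent_lt1 z : Normc.normc z < 1 ->
  exists G, is_resolvent (cmvU alpha) z G.
Proof.
move=> z1; have [G [bG G1 G2]] := neumann_inverse Uinv_iso z1.
have bB := local_isometry_bounded Uinv_iso.
exists (G \o cmvUinv alpha); split; first exact: bounded_linear_comp.
- move=> f lf; have := G1 _ (bounded_linear_l2 bB lf).
  rewrite /=; move: (G _) => g /(congr1 (cmvU alpha)).
  by rewrite cmvUinvK -scaleNr addrC linU cmvUinvK scaleNr addrC.
- move=> f lf /=; rewrite -scaleNr addrC linUinv cmvUK addrC scaleNr.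
  exact: G2.
Qed.

(** From U - z = - z (1 - z^-1 U). *)
Lemma cmvU_resolvent_gt1 z : 1 < Normc.normc z ->
  exists G, is_resolvent (cmvU alpha) z G.
Proof.
move=> z1; have z0 : z != 0.
  by apply: contraTneq z1 => ->; rewrite Normc.normc0 -leNgt.
have z1' : Normc.normc z^-1 < 1.
  by rewrite Normc.normcV invf_lt1// (lt_trans ltr01).
have [G [bG G1 G2]] := neumann_inverse U_iso z1'.
exists (G \o (fun f => - z^-1 *: f)); split.
- exact: bounded_linear_comp (bounded_linear_scale _).
- move=> f lf; have := G1 _ (l2Z (- z^-1) lf); rewrite /=; move: (G _) => g.
  move=> /(congr1 (fun h => - z *: h)).
  rewrite scalerBr !scalerA mulrNN !mulNr divff// scale1r scaleN1r opprK.
  by rewrite scaleNr addrC.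
- move=> f lf /=; rewrite scalerBr !scalerA mulNr mulVf// scaleN1r opprK.
  by rewrite addrC scaleNr; exact: G2.
Qed.

Lemma normc_neq1 (z : R[i]) : `|z| != 1 -> Normc.normc z != 1.
Proof. by apply: contraNneq; rewrite normcR => ->. Qed.

Lemma cmvU_resolvent z : `|z| != 1 -> exists G, is_resolvent (cmvU alpha) z G.
Proof.
move=> /normc_neq1; rewrite neq_lt => /orP[]; first exact: cmvU_resolvent_lt1.
exact: cmvU_resolvent_gt1.
Qed.

Lemma resolventP z : `|z| != 1 ->
  is_resolvent (cmvU alpha) z (resolvent (cmvU alpha) z).
Proof.
by move=> /cmvU_resolvent[G HG]; exact: (xgetPex _ (ex_intro _ G HG)).
Qed.

Lemma cmvU_notin_spectrum z : `|z| != 1 -> ~ spectrum (cmvU alpha) z.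
Proof. by move=> /cmvU_resolvent exG; apply. Qed.

(** Although [resolvent] is a choice, being a left inverse of U - z on l^2 pins its value at (U - z)
    g. *)
Lemma entry_resolvent z (k k' : int) (g : int -> R[i]) : `|z| != 1 ->
  l2 setT g -> cmvU alpha g - z *: g = @basis_vector R k' ->
  entry (resolvent (cmvU alpha) z) k k' = g k.
Proof. by move=> /resolventP[_ _ G2] lg e; rewrite /entry -e G2. Qed.

Lemma eigen_eq0 z g : `|z| != 1 -> l2 setT g -> cmvU alpha g = z *: g -> g = 0.
Proof.
move=> /cmvU_resolvent[G [[lG _] _ G2]] lg e.
have := G2 _ lg; rewrite e subrr => <-.
have l0 : l2 setT (0 : int -> R[i]) by apply: l2_0.
have := lG (-1) 0 0 l0 l0; rewrite scaler0 addr0 => {1}->.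
by rewrite scaleN1r addNr.
Qed.

Lemma series_neumann_sum z f k n :
  series (fun n => iter n (cmvUinv alpha) f k * (z - 0) ^+ n) n =
  neumann_sum (cmvUinv alpha) z n f k.
Proof.
have T m : neumann_term (cmvUinv alpha) z m f =
    z ^+ m *: iter m (cmvUinv alpha) f.
  elim: m => [|m IH]; first by rewrite scale1r.
  by rewrite neumann_term_recl IH (opZ linUinv) scalerA -exprS.
elim: n => [|n IH]; first by rewrite /series /= big_geq.
rewrite (neumann_sum_recr z Uinv_iso) /series /= big_nat_recr//= subr0.
rewrite -[LHS]/(_ + _) -[RHS]/(neumann_sum (cmvUinv alpha) z n f k +
  neumann_term (cmvUinv alpha) z n f k).
by rewrite -IH T /series/= subr0 mulrC.
Qed.

(** The Taylor coefficients are the entries (k, k') of U^-(n+1), and the series converges to the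
    entry on the whole open unit disk. *)
Lemma analytic_entry_resolvent (k k' : int) :
  analytic_at (fun z => entry (resolvent (cmvU alpha) z) k k') 0.
Proof.
exists (fun n => iter n (cmvUinv alpha) (cmvUinv alpha (@basis_vector R k')) k).
have := near0_norm_lt1 R[i]; apply: filterS => z.
rewrite normcR -[1]/(1%:C%C) ltcR => z1.
have nz1 : `|z| != 1 by rewrite normcR; apply/eqP => -[] /eqP; rewrite lt_eqF.
have [bG G1 _] := resolventP nz1.
set h := resolvent (cmvU alpha) z (@basis_vector R k').
have lh : l2 setT h by apply: bounded_linear_l2 => //; exact: l2_basis.
have [C C0 hC] := l2_sqnorm lh.
(* With h the column of the resolvent, the partial sums telescope to h - (z U^-1)^n h, which leaves
   a remainder of at most C |z|^n in each entry. *)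
have -> : cmvUinv alpha (@basis_vector R k') = h - z *: cmvUinv alpha h.
  by rewrite -(G1 _ (@l2_basis R k')) -/h -!scaleNr addrC linUinv cmvUK addrC.
rewrite -[X in _ --> X]/(h k); apply/cvgrPdist_lt => e e0.
(* In the partial order of [R[i]], a positive number is real. *)
have [e0' ->] : 0 < complex.Re e /\ e = (complex.Re e)%:C%C.
  by move: e0; rewrite ltcE => /andP[/eqP]; case: e => a b /= -> ->.
have cv : geometric C (Normc.normc z) n @[n --> \oo] --> 0.
  by apply: cvg_geometric; rewrite ger0_norm ?normc_ge0.
have ev : \forall n \near \oo,
  geometric C (Normc.normc z) n < complex.Re e by exact: (cvgr_lt _ cv).
near=> n.
have Cn : geometric C (Normc.normc z) n < complex.Re e by near: n.
rewrite series_neumann_sum (neumann_sum_telescope _ Uinv_iso).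
have -> : (h - neumann_term (cmvUinv alpha) z n h) k =
  h k - neumann_term (cmvUinv alpha) z n h k by [].
rewrite opprB addrC subrK normcR ltcR; apply: le_lt_trans Cn.
exact: normc_neumann_term_le.
Unshelve. all: by end_near.
Qed.

End Resolvent.

(** * Solutions of the transfer recursion *)

(* The [k]-th row of [cmvW u = z v] when [b], and of [cmvV v = u] otherwise,
   where [u] and [v] are the components of [x]. *)
Definition cmv_row (R : realType) (alpha : int -> R[i]) (z : R[i])
    (x : int -> 'cV[R[i]]_2) (b : bool) (k : int) : Prop :=
  block_op alpha b (fun j => x j (if b then 0 else 1) 0) k =
  if b then z * x k 1 0 else x k 0 0.

Definition transfer_step (R : realType) (alpha : int -> R[i]) (z : R[i])
    (x : int -> 'cV[R[i]]_2) (k : int) : Prop :=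
  x k = transfer alpha z k *m x (k - 1).

Lemma block_op_last (R : realType) (alpha : int -> R[i]) b f k : oddz k = b ->
  block_op alpha b f k = rho alpha k * f (k - 1) + (alpha k)^* * f k.
Proof. by move=> kb; rewrite block_opE kb eqxx. Qed.

Lemma block_op_first (R : realType) (alpha : int -> R[i]) b f k : oddz k = b ->
  block_op alpha b f (k - 1) = - alpha k * f (k - 1) + rho alpha k * f k.
Proof.
move=> kb; rewrite block_opE oddzB1 kb subrK.
by case: b kb.
Qed.

Lemma cv2_inj (K : Type) (a b c d : K) : cv2 a b = cv2 c d <-> a = c /\ b = d.
Proof.
split=> [/matrixP e|[-> ->]//].
by have := e 0 0; have := e 1 0; rewrite !cv2E.
Qed.

(** Passage from a scattering matrix to a transfer matrix: [x], [x'] are the input and output at the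
    first index of the block, [y], [y'] those at the second. As r <> 0, the second pair can be
    solved for in terms of the first, and conversely. *)
Lemma unitary_stepP (F : fieldType) (a a' r x y x' y' : F) :
  r != 0 -> r ^+ 2 = 1 - a * a' ->
  (- a * x + r * y = x' /\ r * x + a' * y = y') <->
  (y = r^-1 * (a * x + x') /\ y' = r^-1 * (x + a' * x')).
Proof.
move=> r0 e; split=> -[].
  move=> <- <-; split; first by field.
  apply: (mulfI r0); rewrite mulrA divff// mul1r mulrDr mulrA -expr2 e; ring.
move=> -> ->; split; first by field.
by apply: (mulfI r0); rewrite !mulrDr !mulrA -expr2 e; field.
Qed.

(** Rows k - 1 and k make up the block [theta] k. Its input and output are (u, z v) for odd k and
    (v, u) for even k, which accounts for the two shapes of [transfer]. *)
Lemma transfer_stepP (R : realType) (alpha : int -> R[i]) (z : R[i])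
    (x : int -> 'cV[R[i]]_2) (k : int) : `|alpha k| < 1 -> z != 0 ->
  transfer_step alpha z x k <->
  cmv_row alpha z x (oddz k) (k - 1) /\ cmv_row alpha z x (oddz k) k.
Proof.
move=> a1 z0; rewrite /transfer_step /cmv_row block_op_first// block_op_last//.
rewrite {1}(cv2_eta (x k)) {1}(cv2_eta (x (k - 1))) /transfer.
have r0 := rho_neq0 a1; have r2 := rho_sqr alpha k.
have rV : rho alpha k * (rho alpha k)^-1 = 1 by rewrite divff.
case: ifP => kb /=; rewrite -scalemxAl mx22_mul_cv2 unitary_stepP//.
  rewrite [_ *: _]cv2_eta cv2_inj !mxE /=.
  have -> : (rho alpha k)^-1 *
      (x (k - 1) 0 0 + (alpha k)^* * (z * x (k - 1) 1 0)) =
    z * ((rho alpha k)^-1 *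
      (z^-1 * x (k - 1) 0 0 + (alpha k)^* * x (k - 1) 1 0)).
    by field; rewrite r0 z0.
  by split=> -[-> e]; split=> //; [rewrite e|exact: (mulfI z0)].
rewrite [_ *: _]cv2_eta cv2_inj !mxE /= !mul1r.
by split=> -[-> ->]; split=> //; congr (_ * _); rewrite addrC.
Qed.

Lemma transfer_step_sol (R : realType) (alpha : int -> R[i]) (z : R[i]) k0 c k :
  (forall j, `|alpha j| < 1) -> z != 0 ->
  transfer_step alpha z (transfer_sol alpha z k0 c) k.
Proof. by move=> a1 z0; exact: transfer_sol_rec. Qed.

Lemma transfer_step_lin (R : realType) (alpha : int -> R[i]) (z : R[i])
    (a b : R[i]) (x y : int -> 'cV[R[i]]_2) k :
  transfer_step alpha z x k -> transfer_step alpha z y k ->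
  transfer_step alpha z (fun j => a *: x j + b *: y j) k.
Proof.
rewrite /transfer_step => -> ->.
by rewrite mulmxDr -!scalemxAr.
Qed.

Lemma half_line_ind (s : bool) (k0 : int) (P : int -> Prop) :
  P k0 ->
  (forall k, half_line s k0 k -> P k -> P (if s then k + 1 else k - 1)) ->
  forall k, half_line s k0 k -> P k.
Proof.
move=> P0 PS k; case: s PS => PS /= hk.
  have -> : k = k0 + `|k - k0|%N%:Z by lia.
  elim: `|k - k0|%N {hk} => [|n IH]; first by rewrite addr0.
  have -> : k0 + n.+1%:Z = k0 + n%:Z + 1 by lia.
  by apply: PS => //=; lia.
have -> : k = k0 - `|k0 - k|%N%:Z by lia.
elim: `|k0 - k|%N {hk} => [|n IH]; first by rewrite subr0.
have -> : k0 - n.+1%:Z = k0 - n%:Z - 1 by lia.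
by apply: PS => //=; lia.
Qed.

(** The step at k links k - 1 and k; the shift by [s] in the hypotheses retains exactly the steps
    with both indices in the half-line. Going left uses that the transfer matrix, of determinant -1,
    is invertible. *)
Lemma transfer_unique (R : realType) (alpha : int -> R[i]) (z : R[i])
    (s : bool) (k0 : int) (x y : int -> 'cV[R[i]]_2) :
  (forall j, `|alpha j| < 1) -> z != 0 ->
  (forall k, half_line s k0 (k - s%:Z) -> transfer_step alpha z x k) ->
  (forall k, half_line s k0 (k - s%:Z) -> transfer_step alpha z y k) ->
  x k0 = y k0 -> forall k, half_line s k0 k -> x k = y k.
Proof.
move=> a1 z0 xs ys xy0; apply: half_line_ind => // k hk xyk.
case: s xs ys hk => xs ys hk.
  have hk1 : half_line true k0 (k + 1 - 1) by rewrite addrK.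
  have := xs _ hk1; have := ys _ hk1; rewrite /transfer_step addrK => -> ->.
  by rewrite xyk.
have ux : transfer alpha z k \in unitmx.
  by rewrite unitmxE det_transfer// unitfE oppr_eq0 oner_eq0.
have hk0 : half_line false k0 (k - 0) by rewrite subr0.
have := xs _ hk0; have := ys _ hk0; rewrite /transfer_step => ey ex.
move: xyk; rewrite ex ey => /(congr1 (mulmx (invmx (transfer alpha z k)))).
by rewrite !mulKmx.
Qed.

Lemma half_lineT (k0 k : int) : half_line true k0 k \/ half_line false k0 k.
Proof. by rewrite /=; lia. Qed.

Lemma transfer_uniqueT (R : realType) (alpha : int -> R[i]) (z : R[i])
    (k0 : int) (x y : int -> 'cV[R[i]]_2) :
  (forall j, `|alpha j| < 1) -> z != 0 ->
  (forall k, transfer_step alpha z x k) ->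
  (forall k, transfer_step alpha z y k) ->
  x k0 = y k0 -> x = y.
Proof.
move=> a1 z0 xs ys xy0; apply/funext => k.
by case: (half_lineT k0 k); apply: (transfer_unique a1 z0) xy0 k => *.
Qed.

Lemma sqnorm_half_lineS (R : realType) (s : bool) (k : int) (f : int -> R[i]) :
  sqnorm (half_line s k) f = ((Normc.normc (f k) ^+ 2)%:E +
    sqnorm (half_line s (if s then k + 1 else k - 1)%R) f)%E.
Proof.
rewrite (sqnormID [set k]) -sqnorm_set1; congr (sqnorm _ _ + sqnorm _ _)%E.
  apply/seteqP; split=> j /=; first by case.
  by move=> ->; split=> //; case: s => /=.
by case: s; apply/seteqP; split=> j /=; lia.
Qed.

Lemma l2_half_lineS (R : realType) (s : bool) (k : int) (f : int -> R[i]) :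
  l2 (half_line s (if s then k + 1 else k - 1)) f -> l2 (half_line s k) f.
Proof.
by rewrite /l2 => lf; rewrite (sqnorm_half_lineS _ k) lte_add_pinfty// ltry.
Qed.

Lemma l2_half_line (R : realType) (s : bool) (k k' : int) (f : int -> R[i]) :
  l2 (half_line s k) f -> l2 (half_line s k') f.
Proof.
have W j : half_line s j k' -> l2 (half_line s j) f -> l2 (half_line s k') f.
  by move=> h; apply: l2W => i; case: (s) h => /=; lia.
have [//|h] : half_line s k k' \/ half_line s k' k by case: (s) => /=; lia.
  exact: W.
have ind := half_line_ind (s := s) (k0 := k')
  (P := fun j => l2 (half_line s j) f -> l2 (half_line s k') f).
apply: (ind _ _ _ h) => // j _ IH lf.
exact/IH/l2_half_lineS.
Qed.

(** * Weyl solutions *)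

Lemma eq_block_op (R : realType) (alpha beta : int -> R[i]) b f k :
  oddz k = b -> alpha k = beta k ->
  block_op alpha b f (k - 1) = block_op beta b f (k - 1) /\
  block_op alpha b f k = block_op beta b f k.
Proof.
by move=> kb e; rewrite !block_op_first ?block_op_last// /rho e.
Qed.

(** A set that splits no block of W gives ||u|| = |z| ||v||, and one that splits no block of V gives
    ||v|| = ||u||. *)
Lemma sqnorm_cmv_row (R : realType) (alpha : int -> R[i]) (z : R[i])
    (x : int -> 'cV[R[i]]_2) (b : bool) (D : set int) :
  (forall k, `|alpha k| <= 1) -> blocked b D ->
  (forall k, D k -> cmv_row alpha z x b k) ->
  sqnorm D (fun k => x k (if b then 0 else 1) 0) =
  ((if b then Normc.normc z ^+ 2 else 1)%:E *
    sqnorm D (fun k => (x k (if b then 1 else 0) 0)%R))%E.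
Proof.
move=> a1 bD xb; rewrite -(sqnorm_block_op _ a1 bD).
rewrite (@eq_sqnorm _ _ _
  ((if b then z else 1) *: fun k => x k (if b then 1 else 0) 0)).
  by rewrite sqnormZ; case: (b) => //; rewrite Normc.normc1 expr1n.
move=> k Dk; have := xb k Dk; rewrite /cmv_row => ->.
by case: (b) => //; exact: esym (mul1r _).
Qed.

Lemma cmv_rowT (R : realType) (alpha : int -> R[i]) (z : R[i])
    (x : int -> 'cV[R[i]]_2) : (forall k, `|alpha k| < 1) -> z != 0 ->
  (forall k, transfer_step alpha z x k) -> forall b k, cmv_row alpha z x b k.
Proof.
move=> a1 z0 xs b k; case: (boolP (oddz k == b)) => [/eqP kb|kb].
  by have /(transfer_stepP _ (a1 k) z0)[_] := xs k; rewrite kb.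
have /(transfer_stepP _ (a1 (k + 1)) z0)[+ _] := xs (k + 1).
by rewrite addrK oddzD1; case: (oddz k) b kb => [] [].
Qed.

Section WeylSolutions.
Context (R : realType) (alpha : int -> R[i]) (z : R[i]) (k0 : int).
Hypothesis alpha_lt1 : forall k, `|alpha k| < 1.
Hypothesis z_neq0 : z != 0.
Hypothesis z_norm : `|z| != 1.

Let alpha_le1 k : `|alpha k| <= 1.
Proof. exact: ltW. Qed.

Definition l2_sol (s : bool) (x : int -> 'cV[R[i]]_2) : Prop :=
  (forall k, transfer_step alpha z x k) /\
  forall i, l2 (half_line s k0) (fun k => x k i 0).

(* Comparing the norms of [u] and [v] over the half-lines that start at [k0]
   and next to [k0] shows that [p_+, r_+] cannot be square summable. *)
Lemma sol_pr_not_l2 s : ~ l2_sol s (sol_pr alpha z k0).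
Proof.
move=> [xs]; set x := sol_pr alpha z k0 => xl2.
have xrow := cmv_rowT alpha_lt1 z_neq0 xs.
set k1 := if s then k0 + 1 else k0 - 1.
have bK := @blocked_half_line s k0; have bK1 := @blocked_half_line s k1.
have eqK b D bD :=
  @sqnorm_cmv_row _ _ z x b D alpha_le1 bD (fun k _ => xrow b k).
(* [k0] and [k1] have opposite parities, so one identity comes from V and the other from W. *)
have e0 := eqK _ _ bK; have e1 := eqK _ _ bK1.
have k01 : oddz k1 = ~~ oddz k0.
  by rewrite /k1; case: (s); rewrite ?oddzD1 ?oddzB1.
have [U U0 eU] := l2_sqnorm (l2_half_line k1 (xl2 0)).
have [V V0 eV] := l2_sqnorm (l2_half_line k1 (xl2 1)).
have z1 : Normc.normc z ^+ 2 != 1.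
  rewrite sqrf_eq1 negb_or (normc_neq1 z_norm) gt_eqF//.
  by rewrite (lt_le_trans _ (normc_ge0 z))// ltrN10.
have x0 : x k0 = if oddz k0 then cv2 z 1 else cv2 1 1.
  exact: transfer_sol_init.
(* On the right the comparison gives (1 - |z|^2) (1 + V^2) = 0, which is absurd. On the left the
   terms at [k0] cancel and only U = V = 0 follows; the solution then vanishes at k0 - 1, hence at
   k0, against its initial value. *)
have contra : U = 0 -> V = 0 -> s = false -> False.
  move=> U00 V00 s0.
  have xk1 : x k1 = 0.
    rewrite (cv2_eta (x k1)).
    have hk1 : half_line s k1 k1 by case: (s) => /=.
    rewrite (@sqnorm_eq0 _ _ (fun k => x k 0 0) k1 _ hk1) ?eU ?U00 ?expr0n//.
    rewrite (@sqnorm_eq0 _ _ (fun k => x k 1 0) k1 _ hk1) ?eV ?V00 ?expr0n//.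
    by apply/matrixP => i j; rewrite !mxE; case: ifP.
  have := xs k0; rewrite /transfer_step.
  rewrite -[k0 - 1]/(if false then k0 + 1 else k0 - 1) -s0.
  rewrite -/k1 -/x xk1 mulmx0 x0 => /matrixP /(_ 1 0).
  by case: ifP => _; rewrite !mxE /= => /eqP; rewrite oner_eq0.
move: e0 e1; rewrite k01 addbN !(sqnorm_half_lineS _ k0) -/k1 x0.
set t := Normc.normc z ^+ 2 in z1 *.
have n1 : Normc.normc (1 : R[i]) ^+ 2 = 1 by rewrite Normc.normc1 expr1n.
move: contra eU eV; case: (s); case: (oddz k0) => contra eU eV /=;
  rewrite !cv2E n1 -?/t; move: eU eV => /= -> ->; rewrite ?mul1e.
- move=> [e1] [e2]; have /eqP : (1 - t) * (1 + V ^+ 2) = 0 by lra.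
  rewrite mulf_eq0 subr_eq0 eq_sym (negbTE z1) /= gt_eqF//.
  by rewrite ltr_pwDl// sqr_ge0.
- move=> [e1] [e2]; have /eqP : (1 - t) * (1 + V ^+ 2) = 0 by lra.
  rewrite mulf_eq0 subr_eq0 eq_sym (negbTE z1) /= gt_eqF//.
  by rewrite ltr_pwDl// sqr_ge0.
- move=> [e1] [e2]; have /eqP : (1 - t) * V ^+ 2 = 0 by lra.
  rewrite mulf_eq0 subr_eq0 eq_sym (negbTE z1) /= sqrf_eq0 => /eqP v0.
  apply: contra => //; apply/eqP; rewrite -sqrf_eq0 -e2 v0 expr0n //.
- move=> [e1] [e2]; have /eqP : (1 - t) * V ^+ 2 = 0 by lra.
  rewrite mulf_eq0 subr_eq0 eq_sym (negbTE z1) /= sqrf_eq0 => /eqP v0.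
  apply: contra => //; apply/eqP; rewrite -sqrf_eq0 e2 v0 expr0n /= mulr0 //.
Qed.

(* Setting [alpha 0 = 1] decouples the two half-lines that meet between -1 and
   0; the resolvent of the decoupled operator, applied to a basis vector next to
   the cut, is a nonzero l^2 solution of the original recursion on one side. *)
Lemma exists_l2_sol s : exists2 x, l2_sol s x & x != 0.
Proof.
pose beta k := if k == 0 then 1 else alpha k.
have beta_le1 k : `|beta k| <= 1.
  by rewrite /beta; case: ifP => _; rewrite ?normr1.
pose m : int := if s then 0 else -1.
have [G [bG G1 _]] := cmvU_resolvent beta_le1 z_norm.
pose g := G (@basis_vector R m).
have lg : l2 setT g by apply: bounded_linear_l2 => //; exact: l2_basis.
pose v := z^-1 *: cmvW beta g.
have lv : l2 setT v.
  apply: l2Z; rewrite /l2 sqnorm_block_op//.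
pose x k := cv2 (g k) (v k).
have xrowW k : cmv_row beta z x true k.
  rewrite /cmv_row.
  have -> : (fun j => x j 0 0) = g by apply/funext => j; rewrite cv2E.
  by rewrite cv2E /v /= [RHS](mulVKf z_neq0).
have Vv k : cmvV beta v k = g k + z^-1 * basis_vector R m k.
  rewrite /v /cmvV (opZ (block_op_linear beta false)).
  have := congr1 (fun h => h k) (G1 _ (@l2_basis R m)); rewrite -/g => <-.
  rewrite -/(cmvU beta g) -[LHS]/(z^-1 * cmvU beta g k).
  rewrite -[X in _ = _ + _ * X]/(cmvU beta g k - z * g k).
  by rewrite mulrBr mulKf// addrC subrK.
have xrowV k : k != m -> cmv_row beta z x false k.
  move=> km; rewrite /cmv_row.
  have -> : (fun j => x j 1 0) = v by apply/funext => j; rewrite cv2E.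
  by rewrite cv2E -/(cmvV beta v) Vv /basis_vector (negbTE km) mulr0 addr0.
(* These k avoid the altered index 0, and for even k, by parity, the rows k - 1 and k of V also
   avoid the source at [m]. *)
have xs k : half_line s m (k - s%:Z) -> transfer_step alpha z x k.
  move=> hk; have k0' : k != 0 by move: hk; rewrite /m; case: (s) => /=; lia.
  have kE : beta k = alpha k by rewrite /beta (negbTE k0').
  have row := eq_block_op _ (erefl (oddz k)) kE.
  apply/transfer_stepP => //; rewrite /cmv_row -(row _).1 -(row _).2.
  split; rewrite -/(cmv_row _ _ _ _ _).
    case kb: (oddz k); first exact: xrowW.
    apply: xrowV; move: hk kb; rewrite /m /oddz.
    by case: (s) => /=; lia.
  case kb: (oddz k); first exact: xrowW.
  apply: xrowV; move: hk kb; rewrite /m /oddz.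
  by case: (s) => /=; lia.
(* As [rho beta 0] = 0, row [m] of the decoupled V involves only [v m]; if [x m] vanished, so would
   the source z^-1 in that row. *)
have xm : x m != 0.
  apply/eqP => xm0; have := Vv m; rewrite /cmvV.
  have gm : g m = 0 by rewrite -(cv2E (g m) (v m)).1 -/(x m) xm0 mxE.
  have vm : v m = 0 by rewrite -(cv2E (g m) (v m)).2 -/(x m) xm0 mxE.
  have rho0 : rho beta 0 = 0 by rewrite /rho /beta normr1 expr1n subrr sqrtC0.
  have -> : block_op beta false v m = 0.
    move: vm; rewrite /m; case: (s) => vm.
      by rewrite block_op_last// rho0 vm mul0r mulr0 addr0.
    rewrite -(sub0r (1 : int)) block_op_first// rho0 mul0r addr0.
    by rewrite sub0r vm mulr0.
  rewrite gm add0r /basis_vector eqxx mulr1 => /esym/eqP.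
  by rewrite invr_eq0 (negbTE z_neq0).
(* [x] obeys the recursion for [alpha] only on its side of the cut; [y] continues it across the
   cut. *)
pose y := transfer_sol alpha z m (x m).
have ys k : transfer_step alpha z y k by exact: transfer_step_sol.
have yx k : half_line s m k -> y k = x k.
  apply: (transfer_unique alpha_lt1 z_neq0) => //.
  exact: transfer_sol_init.
exists y; last first.
  apply/eqP => y0; move/eqP: xm; apply; rewrite -yx ?y0//.
  by rewrite /m; case: (s).
split=> // i; apply: (@l2_half_line _ _ m).
have lx : l2 setT (fun k => x k i 0).
  have [->|->] := ord2P i.
    by apply: eq_l2 lg => k _; rewrite cv2E.
  by apply: eq_l2 lv => k _; rewrite cv2E.
apply: (@eq_l2 _ _ (fun k => x k i 0)) => [k hk|]; first by rewrite yx.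
by apply: l2W lx.
Qed.

Lemma sol_basis (c : 'cV[R[i]]_2) : exists a b : R[i],
  c = a *: sol_qs alpha z k0 k0 + b *: sol_pr alpha z k0 k0.
Proof.
rewrite /sol_qs /sol_pr !transfer_sol_init (cv2_eta c).
case: ifP => _.
  exists ((c 0 0 / z - c 1 0) / 2), ((c 0 0 / z + c 1 0) / 2).
  by apply/matrixP => i j; rewrite !mxE; case: ifP => _; field.
exists ((c 1 0 - c 0 0) / 2), ((c 1 0 + c 0 0) / 2).
by apply/matrixP => i j; rewrite !mxE; case: ifP => _; field.
Qed.

Lemma l2_solZ s c x : l2_sol s x -> l2_sol s (fun k => c *: x k).
Proof.
move=> [xs lx]; split=> [k|i].
  have := transfer_step_lin c 0 (xs k) (xs k).
  by rewrite /transfer_step !scale0r !addr0.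
apply: (@eq_l2 _ _ (c *: (fun k => x k i 0))); last exact: l2Z.
by move=> k _; rewrite mxE.
Qed.

(** The point is that [weyl_M] is not the default of [xget]. Write an l^2 solution as a q + b p:
    since p is not l^2, a <> 0, and b / a is an admissible value. *)
Lemma l2_sol_weyl s : l2_sol s (fun k => weyl_sol alpha s z k k0).
Proof.
have pstep k : transfer_step alpha z (sol_pr alpha z k0) k.
  exact: transfer_step_sol.
have qstep k : transfer_step alpha z (sol_qs alpha z k0) k.
  exact: transfer_step_sol.
split=> [k|].
  have := transfer_step_lin 1 (weyl_M alpha s z k0) (qstep k) (pstep k).
  by rewrite /transfer_step !scale1r.
suff ex : exists m, forall i, l2 (half_line s k0)
    (fun k => (sol_qs alpha z k0 k + m *: sol_pr alpha z k0 k) i 0).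
  exact: (xgetPex 0 ex).
have [x lx x0] := exists_l2_sol s.
have [a [b xab]] := sol_basis (x k0).
have xE : x = fun k => a *: sol_qs alpha z k0 k + b *: sol_pr alpha z k0 k.
  apply: (transfer_uniqueT alpha_lt1 z_neq0 _ _ xab) => k; first by case: lx.
  exact: (transfer_step_lin a b (qstep k) (pstep k)).
have a0 : a != 0.
  apply/eqP => a0; have b0 : b != 0.
    apply: (contra_neq _ x0) => b0; rewrite xE a0 b0.
    by apply/funext => k; rewrite !scale0r addr0.
  apply: (@sol_pr_not_l2 s).
  have -> : sol_pr alpha z k0 = fun k => b^-1 *: x k; last exact: l2_solZ.
  by apply/funext => k; rewrite xE a0 scale0r add0r scalerA mulVf// scale1r.
exists (b / a) => i; have [_ /(_ i)] := l2_solZ a^-1 lx.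
apply: eq_l2 => k _; rewrite xE scalerDr !scalerA mulVf// scale1r.
by rewrite mulrC.
Qed.

Lemma weyl_sol_neq0 s : weyl_sol alpha s z k0 k0 != 0.
Proof.
rewrite /weyl_sol /sol_qs /sol_pr !transfer_sol_init; apply/eqP => /matrixP e.
have := e 0 0; have := e 1 0; rewrite !mxE.
case: ifP => _; rewrite !mxE /= mulr1.
  move/eqP; rewrite addrC subr_eq0 => /eqP ->; rewrite mul1r -mulr2n => /eqP.
  by rewrite mulrn_eq0 (negbTE z_neq0).
move=> h1 h2; have /eqP : (2 : R[i]) = 0.
  by rewrite -[RHS](subrr 0) -{1}h1 -h2; ring.
by rewrite pnatr_eq0.
Qed.

Lemma weyl_M_neq : weyl_M alpha true z k0 != weyl_M alpha false z k0.
Proof.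
apply/eqP => eM; have [xs lp] := l2_sol_weyl true.
have [_ lm] := l2_sol_weyl false.
pose x k := weyl_sol alpha true z k k0.
have xE k : weyl_sol alpha false z k k0 = x k by rewrite /weyl_sol -eM.
have lx i : l2 setT (fun k => x k i 0).
  have -> : setT = half_line true k0 `|` half_line false k0.
    by apply/seteqP; split=> // k _; exact: half_lineT.
  apply: l2U; first exact: lp.
  by apply: (eq_l2 _ (lm i)) => k _; rewrite xE.
have row := cmv_rowT alpha_lt1 z_neq0 xs.
have Wu : cmvW alpha (fun k => x k 0 0) = z *: (fun k => x k 1 0).
  by apply/funext => k; exact: row true k.
have Vv : cmvV alpha (fun k => x k 1 0) = fun k => x k 0 0.
  by apply/funext => k; exact: row false k.
have u0 : (fun k => x k 0 0) = 0.
  apply: (eigen_eq0 alpha_le1 z_norm) => //.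
  by rewrite /cmvU Wu /cmvV (opZ (block_op_linear alpha false)) -/(cmvV _ _) Vv.
have v0 : (fun k => x k 1 0) = 0.
  have := Wu; rewrite u0 /cmvW (op0 (block_op_linear alpha true)).
  move=> /esym/eqP; rewrite scaler_eq0 (negbTE z_neq0) => /eqP.
  exact.
have := weyl_sol_neq0 true; rewrite -/(x k0) (cv2_eta (x k0)).
rewrite -[x k0 0 0]/((fun k => x k 0 0) k0) u0.
rewrite -[x k0 1 0]/((fun k => x k 1 0) k0) v0 => /eqP; apply.
by apply/matrixP => i j; rewrite !mxE; case: ifP.
Qed.

End WeylSolutions.

(** * Wronskians and the Green function *)

Lemma mx22_eta (K : Type) (M : 'M[K]_2) :
  M = mx22 (M 0 0) (M 0 1) (M 1 0) (M 1 1).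
Proof.
apply/matrixP => i j; rewrite !mxE.
by have [->|->] := ord2P i; have [->|->] := ord2P j.
Qed.

Lemma wronskian_mulmx (K : comPzRingType) (M : 'M[K]_2) (x y : 'cV[K]_2) :
  wronskian (M *m x) (M *m y) = \det M * wronskian x y.
Proof.
rewrite (mx22_eta M) (cv2_eta x) (cv2_eta y) !mx22_mul_cv2 det_mx22.
by rewrite !wronskian_cv2; ring.
Qed.

Lemma wronskian_sol (R : realType) (alpha : int -> R[i]) (z : R[i])
    (k0 k : int) (x y : int -> 'cV[R[i]]_2) :
  (forall j, `|alpha j| < 1) -> z != 0 ->
  (forall j, transfer_step alpha z x j) ->
  (forall j, transfer_step alpha z y j) ->
  (-1) ^ k * wronskian (x k) (y k) = (-1) ^ k0 * wronskian (x k0) (y k0).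
Proof.
move=> a1 z0 xs ys.
pose w j := (-1) ^ j * wronskian (x j) (y j).
have wS j : w j = w (j - 1).
  rewrite /w xs ys wronskian_mulmx det_transfer// !exprz_sign oddzB1.
  by case: (oddz j); rewrite /= ?mulN1r ?mul1r ?opprK.
suff w0 j : w j = w k0 by exact: w0.
have [] := half_lineT k0 j; move: j; apply: half_line_ind => // j _ /= <-.
  by rewrite wS addrK.
by rewrite -wS.
Qed.

(** Row [j] sees only [j] and its partner in the block, so a sequence glued from two Weyl solutions
    may be replaced there by one of them. *)
Lemma block_op_local (R : realType) (alpha : int -> R[i]) b
    (f h : int -> R[i]) j :
  f j = h j -> (oddz j = b -> f (j - 1) = h (j - 1)) ->
  (oddz j <> b -> f (j + 1) = h (j + 1)) ->
  block_op alpha b f j = block_op alpha b h j.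
Proof.
move=> ej e1 e2; rewrite !block_opE ej.
by case: eqP => [/e1 ->|/e2 ->].
Qed.

Section Green.
Context (R : realType) (alpha : int -> R[i]) (k0 k1 : int) (z : R[i]).
Hypothesis alpha_lt1 : forall k, `|alpha k| < 1.
Hypothesis z_neq0 : z != 0.
Hypothesis z_norm : `|z| != 1.

Local Notation u s k := (weyl_u alpha s z k k0).
Local Notation v s k := (weyl_v alpha s z k k0).
Local Notation ut s k := (weyl_ut alpha s z k k0).
Local Notation dM := (weyl_M alpha true z k0 - weyl_M alpha false z k0).
Local Notation W k := (wronskian (cv2 (u true k) (v true k))
                                 (cv2 (u false k) (v false k))).

Lemma wronskian_weyl k : W k = (-1) ^ k * dM * (if oddz k0 then 2 * z else 2).
Proof.
have cE s j : cv2 (u s j) (v s j) = weyl_sol alpha s z j k0.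
  by rewrite [RHS]cv2_eta.
have [xs _] := l2_sol_weyl k0 alpha_lt1 z_neq0 z_norm true.
have [ys _] := l2_sol_weyl k0 alpha_lt1 z_neq0 z_norm false.
have := wronskian_sol k0 k alpha_lt1 z_neq0 xs ys; rewrite -!cE.
have -> : W k0 = (-1) ^ k0 * dM * (if oddz k0 then 2 * z else 2).
  rewrite !cE /wronskian /weyl_sol /sol_qs /sol_pr !transfer_sol_init.
  move: (weyl_M _ true _ _) (weyl_M _ false _ _) => m1 m2; rewrite exprz_sign.
  by case: ifP => _; rewrite !mxE /=; ring.
rewrite !exprz_sign.
move: (W k) (dM) => w d.
case: (oddz k) => /=; rewrite ?mul1r ?mulN1r; last move=> ->.
  move=> /eqP; rewrite eqr_oppLR => /eqP ->.
  by case: (oddz k0); ring.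
by case: (oddz k0); ring.
Qed.

Lemma dM_neq0 : dM != 0.
Proof. by rewrite subr_eq0; exact: weyl_M_neq. Qed.

Lemma weyl_utE s k : ut s k = u s k / (if oddz k0 then z else 1).
Proof.
rewrite /weyl_ut /weyl_u /weyl_sol /tilde !mxE.
by case: ifP => _; rewrite ?divr1// mulrDl mulrA.
Qed.

Lemma green1_green2 k k' : green1 alpha k0 k1 z k k' = green2 alpha k0 z k k'.
Proof.
rewrite /green1 /green2 wronskian_weyl !weyl_utE.
have d0 := dM_neq0; set d := dM in d0 *.
rewrite !exprz_sign oddzD1.
by case: ((k < k') || _); case: (oddz k1); case: (oddz k0); rewrite /=; field;
  rewrite ?z_neq0 ?d0.
Qed.

Lemma wronskian_weyl_tilde k :
  wronskian (cv2 (ut true k) (v true k)) (cv2 (ut false k) (v false k)) =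
  2 * (-1) ^ k * dM.
Proof.
have := wronskian_weyl k; rewrite !wronskian_cv2 !weyl_utE => e.
rewrite mulrAC [X in _ - X]mulrAC -mulrBl e.
move: (dM) => d.
by case: ifP => _; field.
Qed.

Lemma entry_resolvent_green k k' :
  entry (resolvent (cmvU alpha) z) k k' = green1 alpha k0 k1 z k k'.
Proof.
have [ps lp] := l2_sol_weyl k0 alpha_lt1 z_neq0 z_norm true.
have [ms lm] := l2_sol_weyl k0 alpha_lt1 z_neq0 z_norm false.
have prow := cmv_rowT alpha_lt1 z_neq0 ps.
have mrow := cmv_rowT alpha_lt1 z_neq0 ms.
have alpha_le1 j : `|alpha j| <= 1 by exact: ltW.
set c := (-1) ^ (k1 + 1) / (z * W k1).
(* The prefactor is normalised at [k1], but the alternation of the Wronskian makes its value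
   available at every index; it is used at k'. *)
have cW j : c * W j = - (-1) ^ j / z.
  rewrite /c !wronskian_weyl !exprz_sign oddzD1.
  have d0 := dM_neq0; set d := dM in d0 *.
  by case: (oddz k1); case: (oddz j); case: (oddz k0); rewrite /=; field;
    rewrite ?z_neq0 ?d0.
(* The pair [(g, h)] satisfies [W g = z h] and [V h = g + z^-1 e_k']: off the
   block of [V] that meets [k'] it is a multiple of a Weyl solution, and in that
   block the defect is the Wronskian. *)
pose g j := green1 alpha k0 k1 z j k'.
pose h j :=
  c * (if j <= k' then v false j * v true k' else v false k' * v true j).
have gm j : (j < k') || ((j == k') && oddz j) ->
    g j = ((c * v true k') *: (fun l => u false l)) j.
  by move=> jk; rewrite /g /green1 jk -/c -[RHS]/(c * v true k' * u false j); ring.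
have gp j : ~~ ((j < k') || ((j == k') && oddz j)) ->
    g j = ((c * v false k') *: (fun l => u true l)) j.
  move=> /negbTE jk; rewrite /g /green1 jk -/c.
  by rewrite -[RHS]/(c * v false k' * u true j); ring.
(* [hm] and [hp] overlap: both branches of [h] agree at k', so rows of V next to k' can be read from
   a single Weyl solution. *)
have hm j : j <= k' -> h j = ((c * v true k') *: (fun l => v false l)) j.
  by move=> jk; rewrite /h jk -[RHS]/(c * v true k' * v false j); ring.
have hp j : k' <= j -> h j = ((c * v false k') *: (fun l => v true l)) j.
  move=> jk; rewrite /h -[RHS]/(c * v false k' * v true j).
  case: ifP => [kj|_]; last by ring.
  have -> : j = k' by lia.
  by ring.
rewrite -[RHS]/(g k); apply: (@entry_resolvent _ _ alpha_le1 _ k k' g z_norm).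
  have -> : setT = half_line true k' `|` half_line false k'.
    by apply/seteqP; split=> // j _; exact: half_lineT.
  apply: l2U; apply: l2_half_lineS.
    apply: (@eq_l2 _ _ ((c * v false k') *: (fun l => u true l))) => [j hj|].
      by rewrite gp//; move: hj => /=; lia.
    by apply: l2Z; exact: l2_half_line (lp 0).
  apply: (@eq_l2 _ _ ((c * v true k') *: (fun l => u false l))) => [j hj|].
    by rewrite gm//; move: hj => /=; lia.
  by apply: l2Z; exact: l2_half_line (lm 0).
(* The parity rule places the switch of [g] between two blocks of W: after k' if k' is odd, before
   it if k' is even. Hence W never sees the gluing. *)
have Wg : cmvW alpha g = z *: h.
  apply/funext => j; rewrite -[RHS]/(z * h j) /cmvW.
  case jk: ((j < k') || ((j == k') && oddz j)).
    rewrite (@block_op_local _ _ _ _ ((c * v true k') *: (fun l => u false l))).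
    - rewrite (opZ (block_op_linear alpha true)) hm; last by lia.
      rewrite -[LHS]/(c * v true k' * block_op alpha true (fun l => u false l) j).
      by rewrite (mrow true j : _ = z * v false j) mulrCA.
    - exact: gm.
    - by move=> jo; apply: gm; move: jk; rewrite oddzB1 jo; lia.
    - by move=> jo; apply: gm; move: jk jo; rewrite /oddz; lia.
  rewrite (@block_op_local _ _ _ _ ((c * v false k') *: (fun l => u true l))).
  - rewrite (opZ (block_op_linear alpha true)) hp; last by lia.
    rewrite -[LHS]/(c * v false k' * block_op alpha true (fun l => u true l) j).
    by rewrite (prow true j : _ = z * v true j) mulrCA.
  - by apply: gp; rewrite jk.
  - by move=> jo; apply: gp; move: jk jo; rewrite /oddz; lia.
  - by move=> jo; apply: gp; move: jk jo; rewrite /oddz; lia.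
have Vm j : block_op alpha false ((c * v true k') *: (fun l => v false l)) j =
    c * v true k' * u false j.
  rewrite (opZ (block_op_linear alpha false)).
  by rewrite -(mrow false j : _ = u false j).
have Vp j : block_op alpha false ((c * v false k') *: (fun l => v true l)) j =
    c * v false k' * u true j.
  rewrite (opZ (block_op_linear alpha false)).
  by rewrite -(prow false j : _ = u true j).
have Vh j : cmvV alpha h j = g j + z^-1 * basis_vector R k' j.
  have cWk := cW k'; rewrite wronskian_cv2 exprz_sign in cWk.
  rewrite /cmvV /basis_vector; case: (ltgtP j k') => jk.
  - rewrite (@block_op_local _ _ _ _ ((c * v true k') *: (fun l => v false l))).
    + by rewrite Vm gm ?jk// mulr0 addr0.
    + by apply: hm; lia.
    + by move=> _; apply: hm; lia.
    + by move=> _; apply: hm; lia.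
  - rewrite (@block_op_local _ _ _ _ ((c * v false k') *: (fun l => v true l))).
    + by rewrite Vp gp ?mulr0 ?addr0//; lia.
    + by apply: hp; lia.
    + by move=> _; apply: hp; lia.
    + by move=> _; apply: hp; lia.
  (* In V the partner of k' is k' + 1 for odd k' and k' - 1 for even k', so V h comes from the
     solution of the sign opposite to that used by [g]. The defect is c W k' or its negative, equal
     to z^-1 in both cases. *)
  rewrite jk mulr1; case ko: (oddz k') cWk => cWk.
    rewrite (@block_op_local _ _ _ _ ((c * v false k') *: (fun l => v true l))).
    - rewrite Vp gm ?ltxx ?eqxx ?ko//.
      rewrite -[X in _ = X + _]/(c * v true k' * u false k').
      by move: cWk; rewrite opprK div1r => <-; ring.
    - by apply: hp.
    - by rewrite ko.
    - by move=> _; apply: hp; lia.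
  rewrite (@block_op_local _ _ _ _ ((c * v true k') *: (fun l => v false l))).
  - rewrite Vm gp ?ltxx ?eqxx ?ko//.
    rewrite -[X in _ = X + _]/(c * v false k' * u true k').
    by rewrite -[z^-1]opprK -[z^-1]div1r -mulNr -cWk; ring.
  - by apply: hm.
  - by move=> _; apply: hm; lia.
  - by rewrite ko.
rewrite /cmvU Wg /cmvV (opZ (block_op_linear alpha false)).
apply/funext => j.
rewrite -[LHS]/(z * cmvV alpha h j - z * g j) Vh mulrDr addrC addKr.
by rewrite mulrA divff// mul1r.
Qed.

End Green.

Unset Implicit Arguments.

Theorem lemma3p1 (R : realType) (alpha : int -> R[i])
    (alpha_disk : forall k : int, `|alpha k| < 1) (k0 k1 : int) :
  (forall z : R[i], `|z| != 1 -> z != 0 ->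
     [/\ ~ spectrum (cmvU alpha) z,
         forall k k' : int,
           entry (resolvent (cmvU alpha) z) k k' = green1 alpha k0 k1 z k k' /\
           green1 alpha k0 k1 z k k' = green2 alpha k0 z k k',
         wronskian
           (cv2 (weyl_u alpha true z k1 k0) (weyl_v alpha true z k1 k0))
           (cv2 (weyl_u alpha false z k1 k0) (weyl_v alpha false z k1 k0)) =
         \det (mx22 (weyl_u alpha true z k1 k0) (weyl_u alpha false z k1 k0)
                    (weyl_v alpha true z k1 k0) (weyl_v alpha false z k1 k0)),
         \det (mx22 (weyl_u alpha true z k1 k0) (weyl_u alpha false z k1 k0)
                    (weyl_v alpha true z k1 k0) (weyl_v alpha false z k1 k0)) =
         (-1) ^ k1 * (weyl_M alpha true z k0 - weyl_M alpha false z k0) *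
           (if oddz k0 then 2 * z else 2) &
         wronskian
           (cv2 (weyl_ut alpha true z k1 k0) (weyl_v alpha true z k1 k0))
           (cv2 (weyl_ut alpha false z k1 k0) (weyl_v alpha false z k1 k0)) =
         2 * (-1) ^ k1 * (weyl_M alpha true z k0 - weyl_M alpha false z k0)])
  /\
  (~ spectrum (cmvU alpha) 0 /\
   forall k k' : int, exists g : R[i] -> R[i],
     [/\ analytic_at g 0,
         g 0 = entry (resolvent (cmvU alpha) 0) k k' &
         forall z : R[i], `|z| != 1 -> z != 0 ->
           g z = green1 alpha k0 k1 z k k' /\
           g z = green2 alpha k0 z k k']).
Proof.
have alpha_le1 k : `|alpha k| <= 1 by exact: ltW.
have norm0 : `|0 : R[i]| != 1 by rewrite normr0 eq_sym oner_eq0.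
split=> [z z1 z0|].
  split.
  - exact: cmvU_notin_spectrum.
  - move=> k k'; split; first exact: entry_resolvent_green.
    exact: green1_green2.
  - by rewrite det_mx22 wronskian_cv2.
  - by rewrite det_mx22 -wronskian_weyl// wronskian_cv2.
  - exact: wronskian_weyl_tilde.
split; first exact: cmvU_notin_spectrum.
(* The resolvent entry is itself the extension: it makes sense at 0 and equals both formulas at the
   other points off the circle. *)
move=> k k'; exists (fun z => entry (resolvent (cmvU alpha) z) k k'); split=> //.
  exact: analytic_entry_resolvent.
move=> z z1 z0; have eG := entry_resolvent_green k0 k1 alpha_disk z0 z1 k k'.
by split; rewrite eG//; exact: green1_green2.
Qed.
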